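(* The only separable (real or complex) rearrangement invariant sequence spaces with numerical index $1$ are $c_0$ and $\ell_1$, and the same spaces are the only separable rearrangement invariant sequence spaces with the alternative Daugavet property. That is, for a separable rearrangement invariant space $X$ on $\mathbb{N}$: $X$ has numerical index $1$ if and only if $X$ is $c_0$ or $\ell_1$ (with its usual norm); and $X$ has the alternative Daugavet property if and only if $X$ is $c_0$ or $\ell_1$ (with its usual norm).
   Context: $\mathbb{N}$ carries counting measure. A Köthe function space on $\mathbb{N}$ is a real or complex Banach space $X$ of scalar sequences such that: (i) if $|f|\le|g|$ pointwise and $g\in X$, then $f\in X$ and $\|f\|\le\|g\|$; (ii) $\boldsymbol{1}_A\in X$ for every finite $A\subset\mathbb{N}$. $X'\subset X^*$ denotes the space of integrals, i.e. functionals $f\mapsto\sum_n f(n)g(n)$ with $g$ a sequence such that $gf\in\ell_1$ for all $f\in X$ (identified with $g$), with the norm of $X^*$; it is again a Köthe function space, and $X''=(X')'$. A Köthe function space $X$ on $\mathbb{N}$ is rearrangement invariant (r.i.) if: (1) for every bijection $\tau$ of $\mathbb{N}$ and integrable $f$, $f\in X$ iff $f\tau^{-1}\in X$, and then $\|f\|=\|f\tau^{-1}\|$; (2) $X'$ is a norming subspace of $X^*$ (so $X$ is isometrically a subspace of $X''$), and $X=X''$ or $X$ is the closed linear span of the simple integrable functions of $X''$; (3) $\ell_1\subset X\subset\ell_\infty$ with $\|f\|_X\le\|f\|_1$ for $f\in\ell_1$ and $\|f\|_\infty\le\|f\|_X$ for $f\in X$. Numerical index $1$: every bounded operator $T$ on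 $X$ satisfies $v(T)=\|T\|$, where $v(T)=\sup\{|x^*(Tx)|: x\in S_X,\ x^*\in S_{X^*},\ x^*(x)=1\}$ and $S_X$ is the unit sphere. Alternative Daugavet property: every rank-one bounded operator $T$ on $X$ satisfies $\max_{|\theta|=1}\|\mathrm{Id}+\theta T\|=1+\|T\|$ ($\theta$ ranging over scalars of modulus one). *)

(* Defs.v *)
From HB Require Import structures.
From mathcomp Require Import all_boot all_order all_algebra.
From mathcomp Require Import complex.
From mathcomp Require Import all_classical all_reals.
From mathcomp Require Import topology normedtype sequences numfun.

Set Implicit Arguments.
Unset Strict Implicit.
Unset Printing Implicit Defensive.

Import Order.TTheory GRing.Theory Num.Theory.
Import numFieldNormedType.Exports.

Local Open Scope classical_set_scope.
Local Open Scope ring_scope.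

(* [K] stands for R or R[i] with [R : realType].  As usual for modules over a
   [numFieldType], norms are nonnegative elements of [K]; suprema are taken in
   the partial order of [K], in which nonnegative elements are real, so that on
   sets of norms they are the usual suprema. *)

Section Sequences.
Variable K : numFieldType.
Implicit Types (f g : nat -> K^o) (S B : set (nat -> K^o)).

Definition ksup (A : set K) : K := supremum 0 A.

Definition l1 : set (nat -> K^o) := [set f | cvgn [series (`|f n| : K^o)]_n].

Definition l1norm f : K := limn [series (`|f n| : K^o)]_n.

Definition linfty : set (nat -> K^o) :=
  [set f | exists M : K, forall n, `|f n| <= M].

Definition c0 : set (nat -> K^o) := [set f | f @ \oo --> (0 : K^o)].

Definition supnorm f : K := ksup [set `|f n| | n in [set: nat]].

(* For counting measure a simple function (finitely many values) is integrable
   iff it is absolutely summable. *)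
Definition simple_integrable : set (nat -> K^o) :=
  [set f | finite_set (range f) /\ l1 f].

Definition linear_span S : set (nat -> K^o) :=
  [set f | exists (n : nat) (a : 'I_n -> K) (s : 'I_n -> nat -> K^o),
      (forall i, S (s i)) /\ f = \sum_(i < n) a i *: s i].

Definition pairing f g : K := limn [series ((f n : K) * g n : K^o)]_n.

(* The space of integrals on a space with underlying set [S] ... *)
Definition kdual S : set (nat -> K^o) :=
  [set g | forall f, S f -> l1 (fun n => (g n : K) * f n)].

(* ... and its dual norm, when [B] is the closed unit ball of that space.
   When the space is a Köthe function space, every [g] in its dual defines a
   bounded functional, so that the supremum is that of a bounded set. *)
Definition kdual_norm B g : K := ksup [set `|pairing f g| | f in B].

End Sequences.

Section Operators.
Variable K : numFieldType.

Definition opnorm (E F : normedModType K) (T : E -> F) : K :=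
  ksup [set `|T x| | x in [set x : E | `|x| <= 1]].

Definition numerical_radius (E : normedModType K) (T : E -> E) : K :=
  ksup [set r : K | exists (x : E) (phi : {linear E -> K^o}),
    [/\ `|x| = 1, continuous phi, opnorm phi = 1, phi x = 1
      & r = `|phi (T x)|]].

Definition numerical_index_one (E : normedModType K) : Prop :=
  forall T : {linear E -> E}, continuous T -> numerical_radius T = opnorm T.

Definition rank_one (E : normedModType K) (T : E -> E) : Prop :=
  exists2 y : E, y != 0 & range T = [set a *: y | a in [set: K]].

Definition is_max (A : set K) (m : K) : Prop := A m /\ ubound A m.

Definition alternative_Daugavet (E : normedModType K) : Prop :=
  forall T : {linear E -> E}, continuous T -> rank_one T ->
    is_max [set opnorm (fun x : E => x + theta *: T x)
              | theta in [set theta : K | `|theta| = 1]]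
           (1 + opnorm T).

End Operators.

Definition separable (T : topologicalType) : Prop :=
  exists2 D : set T, countable D & dense D.

(* A Banach space of scalar sequences is a complete normed space [E] together
   with an injective linear map [X] sending each vector to the sequence that it
   is; the space of sequences itself is [range X] with the norm of [E]. *)
Section Kothe.
Variables (K : numFieldType) (E : completeNormedModType K).
Variable X : {linear E -> (nat -> K^o)}.

Record kothe_space : Prop := {
  kothe_inj : injective X ;
  kothe_ideal : forall (f : nat -> K^o) (y : E),
    (forall n, `|f n| <= `|X y n|) -> exists2 x, X x = f & `|x| <= `|y| ;
  kothe_indic : forall A : set nat, finite_set A ->
    range X (\1_A : nat -> K^o) }.

Definition kothe_dual : set (nat -> K^o) := kdual (range X).

Definition kothe_dual_norm : (nat -> K^o) -> K :=
  kdual_norm (X @` [set x : E | `|x| <= 1]).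

Definition kothe_dual_ball : set (nat -> K^o) :=
  [set g | kothe_dual g /\ kothe_dual_norm g <= 1].

Definition kothe_bidual : set (nat -> K^o) := kdual kothe_dual.

Definition kothe_bidual_norm : (nat -> K^o) -> K := kdual_norm kothe_dual_ball.

Definition closed_span_simple : set (nat -> K^o) :=
  [set f | kothe_bidual f /\ forall e : K, 0 < e ->
    exists2 s, linear_span (@simple_integrable K `&` kothe_bidual) s
             & kothe_bidual_norm (f - s) < e].

Record rearrangement_invariant : Prop := {
  ri_kothe : kothe_space ;
  ri_perm : forall (tau tauV : nat -> nat) (f : nat -> K^o),
    cancel tau tauV -> cancel tauV tau -> l1 f ->
    (range X f <-> range X (f \o tauV)) /\
    (forall x y, X x = f -> X y = f \o tauV -> `|x| = `|y|) ;
  ri_norming : forall x : E,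
    `|x| = ksup [set `|pairing (X x) g| | g in kothe_dual_ball] ;
  ri_bidual : range X = kothe_bidual \/ range X = closed_span_simple ;
  ri_l1 : forall f : nat -> K^o, l1 f -> exists2 x, X x = f & `|x| <= l1norm f ;
  ri_linfty : forall x : E, linfty (X x) /\ supnorm (X x) <= `|x| }.

Definition is_c0 : Prop :=
  range X = @c0 K /\ forall x : E, `|x| = supnorm (X x).

Definition is_l1 : Prop :=
  range X = @l1 K /\ forall x : E, `|x| = l1norm (X x).

End Kothe.

(* Main.v *)
Require Import Defs.
From HB Require Import structures.
From mathcomp Require Import all_boot all_order all_algebra.
From mathcomp Require Import complex.
From mathcomp Require Import all_classical all_reals.
From mathcomp Require Import topology normedtype sequences numfun.
From mathcomp Require Import derive realfun.
From mathcomp Require Import ring lra zify.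
Import numFieldNormedType.Exports.
Local Open Scope ring_scope.

(** Let [E] be a separable rearrangement invariant sequence space. If the
   truncations of some vector were not convergent, the sums of subfamilies of
   infinitely many disjoint blocks of it would form a uniformly separated family
   indexed by the subsets of [nat], against separability ([trunc_cauchy]). Hence
   finitely supported sequences are dense and [E] is governed by its norm [N] on
   finitely supported nonnegative real sequences, a lattice norm that is
   invariant under permutations and equals one at the unit vectors [d_i].

   Numerical index one implies the alternative Daugavet property
   ([index_one_daugavet]): a state [phi] at [x] with [|phi (T x)|] close to
   [|T|] gives [|x + theta T x|] close to [1 + |T|] when [theta] corrects the
   phase, and compactness of the unit circle turns [close to] into a maximum.

   The alternative Daugavet property is used only for the operators that send
   [x] to its mean over a finite set [s] times the mean of the unit vectors over
   a finite set [t] ([daugavet_means]): it provides a vector [y] of the unit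
   ball with mean nearly one over [s] and at nearly the maximal distance 2 from
   minus the mean over [t]. Two cases arise.
   - If [N (d_0 + t d_1) <= 1] for some [t > 0], then [y] being far from [- d_0]
     cannot be due to the coordinates of [y] in [s], which a large multiple of
     [d_0] absorbs, nor to those outside of [s] and 0, because exchanging the
     coordinate 0 with one of [s] yields another vector of the unit ball. It must
     be due to the coordinate 0 of [y], which is thus close to one. So if
     [N (1_s) = 1] then adding a point to [s] does not increase the norm, and
     [N] is the supremum norm ([symm_flat_c0]).
   - Otherwise a vector [y] of the unit ball with [y_0] close to one has all
     other coordinates small. If [N (1_t) = #t] and [y] is as above for the
     one-point set [s = {0}], the part of [y] outside of [t] and 0 contributes
     nothing to the distance, by the same exchange; so [d_0] itself is far from
     minus the mean over [t], [N (1_({0} + t)) = #t + 1], and [N] is the norm of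
     [l1] ([symm_exposed_l1]).

   Conversely, on [c0] and on [l1] one finds states at which a given operator
   nearly reaches its norm ([c0_index_one], [l1_index_one]).

   Norms are elements of the scalar field [K], which is only partially ordered
   when it is complex. They are read in [R] by means of the structure
   [norm_values R K], so that one argument serves both fields. *)

Set Implicit Arguments.
Unset Strict Implicit.
Unset Printing Implicit Defensive.
Import Order.TTheory GRing.Theory Num.Theory.
Local Open Scope classical_set_scope.
Local Open Scope ring_scope.

(** * Permutation invariant lattice norms on finitely supported sequences *)

Section SymmetricNorms.
Variable R : realFieldType.
Implicit Types (a b : nat -> R) (s t : seq nat).

Lemma ler_epsM (x y c : R) : 0 <= c ->
  (forall e, 0 < e -> x <= y + c * e) -> x <= y.
Proof.
move=> c0 h; apply/ler_addgt0Pr => e e0.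
have c1 : 0 < c + 1 by lra.
apply: le_trans (h (e / (c + 1)) _) _; first exact: divr_gt0.
rewrite lerD2l mulrCA ler_piMr ?(ltW e0) // ler_pdivrMr ?mul1r //; lra.
Qed.

Definition transposition (i j k : nat) : nat :=
  if k == i then j else if k == j then i else k.

Lemma transpositionK i j : involutive (transposition i j).
Proof.
move=> k; rewrite /transposition.
case: (eqVneq k i) => [->|ki]; first by case: (eqVneq j i) => [->|];
  rewrite ?eqxx.
by case: (eqVneq k j) => [->|kj]; rewrite ?eqxx // (negbTE ki) (negbTE kj).
Qed.

Definition finsupp a := exists m, forall n, (m <= n)%N -> a n = 0.

Definition indseq s : nat -> R := fun k => (k \in s)%:R.

Lemma finsupp_indseq s : finsupp (indseq s).
Proof.
exists (\max_(i <- s) i).+1 => n hn; rewrite /indseq.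
case: (boolP (n \in s)) => // ns; exfalso.
by move: hn; rewrite ltnNge (leq_bigmax_seq (F := id)).
Qed.

Lemma finsuppD a b : finsupp a -> finsupp b -> finsupp (fun k => a k + b k).
Proof.
move=> [m am] [n bn]; exists (maxn m n) => k; rewrite geq_max => /andP[mk nk].
by rewrite am // bn // addr0.
Qed.

Lemma finsuppZ c a : finsupp a -> finsupp (fun k => c * a k).
Proof. by move=> [m am]; exists m => k mk; rewrite am // mulr0. Qed.

Lemma finsupp_mono a b : finsupp b -> (forall k, b k = 0 -> a k = 0) ->
  finsupp a.
Proof. by move=> [m bm] h; exists m => k mk; apply/h/bm. Qed.

Lemma finsupp_transposition i j a : finsupp a ->
  finsupp (a \o transposition i j).
Proof.
move=> [m am]; exists (maxn m (maxn i j).+1) => k;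
  rewrite geq_max => /andP[mk nk].
move: nk; rewrite gtn_max => /andP[ik jk] /=.
by rewrite /transposition (gtn_eqF ik) (gtn_eqF jk) am.
Qed.

Record symmetric_norm (N : (nat -> R) -> R) : Prop := {
  symm_tri : forall a b, finsupp a -> finsupp b ->
    N (fun k => a k + b k) <= N a + N b ;
  symm_scale : forall c a, finsupp a -> 0 <= c -> N (fun k =>
    c * a k) = c * N a ;
  symm_mono : forall a b, finsupp b -> (forall k, 0 <= a k <= b k) ->
    N a <= N b ;
  symm_perm : forall i j a, finsupp a -> N (a \o transposition i j) = N a ;
  symm_unit : forall i, N (indseq [:: i]) = 1 }.

(** What the alternative Daugavet property says about the rank-one operator
   sending [y] to its mean over [s] times the mean of the unit vectors indexed
   by [t]. The two conditions on [N] make the factors of this operator have norm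
   one; phases have been removed by taking moduli of coordinates. *)
Definition daugavet_means (N : (nat -> R) -> R) := forall s t (e : R),
  uniq s -> uniq t -> s != [::] -> t != [::] ->
  N (indseq s) = 1 -> N (indseq t) = (size t)%:R -> 0 < e ->
  exists y : nat -> R, [/\ finsupp y, forall k, 0 <= y k, N y <= 1,
    (size s)%:R * (1 - e) <= \sum_(i <- s) y i
  & 2 - e < N (fun k => y k + (size t)%:R^-1 * indseq t k)].

Variable N : (nat -> R) -> R.
Hypothesis Nsym : symmetric_norm N.

Lemma symm_coord a k : finsupp a -> (forall i, 0 <= a i) -> a k <= N a.
Proof.
move=> fa a0; have := symm_mono Nsym (a := fun i => a k * indseq [:: k] i) fa.
rewrite (symm_scale Nsym) ?(symm_unit Nsym) ?mulr1 //;
  last exact: finsupp_indseq.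
apply=> i; rewrite /indseq mem_seq1; case: eqP => [->|_].
  by rewrite mulr1 a0 lexx.
by rewrite mulr0 lexx a0.
Qed.

Lemma symm_ge0 a : finsupp a -> (forall i, 0 <= a i) -> 0 <= N a.
Proof. by move=> fa a0; apply: le_trans (a0 0%N) (symm_coord 0 fa a0). Qed.

Lemma symm_indseq_shift n : N (indseq (iota 1 n)) = N (indseq (iota 0 n)).
Proof.
rewrite -(symm_perm Nsym 0 n); last exact: finsupp_indseq.
congr N; apply/funext => k /=; rewrite /indseq !mem_iota /transposition.
congr (_%:R); congr nat_of_bool.
by case: (eqVneq k 0%N) => [->|?]; [lia|case: (eqVneq k n) => ?; lia].
Qed.

Lemma symm_sum (I : eqType) (r : seq I) (F : I -> nat -> R) :
  (forall i, i \in r -> finsupp (F i)) ->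
  N (fun k => \sum_(i <- r) F i k) <= \sum_(i <- r) N (F i).
Proof.
have fs0 : finsupp (fun=> 0) by exists 0%N.
elim: r => [|i r IH] h.
  rewrite big_nil (_ : (fun _ => _) = (fun k => 0 * (fun=> 0) k)); last first.
    by apply/funext => k; rewrite big_nil mul0r.
  by rewrite (symm_scale Nsym) // mul0r.
rewrite big_cons (_ : (fun _ => _) = fun k => F i k + \sum_(j <- r) F j k);
  last first.
  by apply/funext => k; rewrite big_cons.
have hr j : j \in r -> finsupp (F j) by move=> jr; apply: h;
  rewrite inE jr orbT.
have fr : finsupp (fun k => \sum_(j <- r) F j k).
  elim: r hr {IH h} => [_|j r IH hr].
    by exists 0%N => k _; rewrite big_nil.
  have [m1 m1P] : finsupp (F j) by apply: hr; rewrite mem_head.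
  have [|m2 m2P] := IH; first by move=> j' jr; apply: hr; rewrite inE jr orbT.
  exists (maxn m1 m2) => k; rewrite geq_max => /andP[h1 h2].
  by rewrite big_cons m1P // m2P // addr0.
apply: le_trans (symm_tri Nsym _ fr) _; first by apply: h; rewrite mem_head.
by rewrite lerD2l; apply: IH.
Qed.

Lemma symm_indseq_le s : N (indseq s) <= (size s)%:R.
Proof.
have fd t : finsupp (indseq t) by exact: finsupp_indseq.
elim: s => [|i s IH].
  rewrite (_ : indseq [::] = fun k => 0 * indseq [::] k); last first.
    by apply/funext => k; rewrite mul0r.
  by rewrite (symm_scale Nsym) // mul0r.
have := symm_tri Nsym (fd [:: i]) (fd s); rewrite (symm_unit Nsym) => h.
rewrite -[size _]/(size s).+1 -natr1 addrC.
apply: le_trans (le_trans h (lerD (lexx _) IH)).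
apply: (symm_mono Nsym); first exact: finsuppD.
move=> k; rewrite /indseq inE mem_seq1 -natrD ler0n ler_nat.
by case: (k == i); case: (k \in s).
Qed.

Lemma symm_le_l1 a n : (forall k, 0 <= a k) -> (forall k, (n <= k)%N ->
  a k = 0) ->
  N a <= \sum_(0 <= k < n) a k.
Proof.
move=> a0 an; have fd i : finsupp (indseq [:: i]) by exact: finsupp_indseq.
have {1}-> : a = fun k => \sum_(i <- index_iota 0 n) a i * indseq [:: i] k.
  apply/funext => k; case: (ltnP k n) => kn.
    rewrite (bigD1_seq k) ?iota_uniq ?mem_index_iota //= /indseq mem_head mulr1.
    rewrite big1 ?addr0 // => i ik.
    by rewrite mem_seq1 eq_sym (negbTE ik) mulr0.
  rewrite an // big1_seq // => i; rewrite mem_index_iota => /= hi.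
  rewrite /indseq mem_seq1 gtn_eqF ?mulr0 //; lia.
apply: le_trans (symm_sum _) _; first by move=> i _; exact: finsuppZ.
by apply: ler_sum => i _; rewrite (symm_scale Nsym) // (symm_unit Nsym) mulr1.
Qed.

(** The norm of [l1] is determined by the norms of the indicators of segments:
   if [c] bounds [a], the sequences [a] and [c - a] cannot both be shorter than
   in [l1] when their sum [c] is not. *)
Lemma symm_l1 : (forall n, N (indseq (iota 0 n)) = n%:R) ->
  forall a n, (forall k, 0 <= a k) -> (forall k, (n <= k)%N -> a k = 0) ->
  N a = \sum_(0 <= k < n) a k.
Proof.
move=> hn a n a0 an; apply/le_anti; rewrite symm_le_l1 //=.
set c := \sum_(0 <= k < n) a k.
have ac k : a k <= c.
  case: (ltnP k n) => kn; last by rewrite an // sumr_ge0.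
  rewrite /c (bigD1_seq k) ?iota_uniq ?mem_index_iota //=.
  by rewrite lerDl sumr_ge0.
have c0 : 0 <= c by exact: le_trans (a0 0%N) (ac _).
pose b k := c * indseq (iota 0 n) k - a k.
have b0 k : 0 <= b k.
  rewrite /b /indseq mem_iota; case: ltnP => kn; rewrite /= ?mulr1 ?subr_ge0 //.
  by rewrite mulr0 an // lexx.
have bn k : (n <= k)%N -> b k = 0.
  by move=> nk; rewrite /b /indseq mem_iota ltnNge nk /= mulr0 an // subr0.
have : N (fun k => a k + b k) <= N a + \sum_(0 <= k < n) b k.
  apply: le_trans (symm_tri Nsym _ _) _; [by exists n|by exists n|].
  by rewrite lerD2l symm_le_l1.
rewrite (_ : (fun _ => _) = fun k => c * indseq (iota 0 n) k); last first.
  by apply/funext => k; rewrite /b addrC subrK.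
rewrite (symm_scale Nsym) ?hn //; last exact: finsupp_indseq.
rewrite sumrB -/c (eq_big_nat _ _ (F2 := fun=> c)); last first.
  by move=> k /andP[_ kn]; rewrite /indseq mem_iota kn mulr1.
rewrite sumr_const_nat subn0 -[c *+ n]mulr_natr; lra.
Qed.

Definition tail n a k := if (n < k)%N then a k else 0.

Lemma finsupp_tail n a : finsupp a -> finsupp (tail n a).
Proof.
by move=> fa; apply: finsupp_mono fa _ => k; rewrite /tail; case: ifP.
Qed.

(** Exchanging the [i]-th and the [j]-th coordinates shows that the tail of [y],
   which goes with a large [j]-th coordinate, goes just as well with a large
   [i]-th one. *)
Lemma symm_swap_tail i j n y c : i != j -> (i <= n)%N -> (j <= n)%N ->
  finsupp y -> (forall k, 0 <= y k) -> N y <= 1 -> 0 <= c -> 1 - c <= y j ->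
  N (fun k => indseq [:: i] k + tail n y k) <= 1 + c.
Proof.
move=> ij ilen jlen fy y0 Ny c0 yj; have fi := finsupp_indseq [:: i].
have fz : finsupp (y \o transposition i j) by exact: finsupp_transposition.
have fci := finsuppZ c fi.
apply: le_trans (symm_mono Nsym (b := fun k =>
  (y \o transposition i j) k + c * indseq [:: i] k) (finsuppD fz fci) _) _.
  move=> k; rewrite /tail /indseq mem_seq1 /= /transposition.
  have yk := y0 k; have yi := y0 i; apply/andP.
  case: (eqVneq k i) => [->|ki]; first by rewrite ltnNge ilen /=; split; lra.
  case: (eqVneq k j) => [->|kj]; first by rewrite ltnNge jlen /= in yk *;
    split; lra.
  by case: ifP => _ /=; split; lra.
apply: le_trans (symm_tri Nsym fz fci) _.
by rewrite (symm_perm Nsym) // (symm_scale Nsym) //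
  (symm_unit Nsym) mulr1 lerD2r.
Qed.

(** Two vectors of norm at most one with a sum of norm nearly two behave
   additively on the whole cone that they span. *)
Lemma symm_dilate c e y b : finsupp y -> (forall k, 0 <= y k) -> finsupp b ->
  N y <= 1 -> 2 - e < N (fun k => y k + b k) -> 1 <= c ->
  c + 1 - c * e <= N (fun k => y k + c * b k).
Proof.
move=> fy y0 fb Ny yb c1; have c0 : 0 <= c by lra.
have : c * N (fun k => y k + b k) <=
    N (fun k => y k + c * b k) + (c - 1) * N y.
  rewrite -!(symm_scale Nsym) //; [|lra|exact: finsuppD].
  have -> : (fun k => c * (y k + b k)) =
            fun k => (y k + c * b k) + (c - 1) * y k.
    by apply/funext => k; ring.
  apply: (symm_tri Nsym); last exact: finsuppZ.
  by apply: finsuppD => //; exact: finsuppZ.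
have := symm_ge0 fy y0; nra.
Qed.

Hypothesis Nmeans : daugavet_means N.

(** The case where the unit ball is flat at the unit vectors. The induction step
   takes the mean over the [n1] points after 0, and [d_0] as target. *)
Lemma symm_flat_c0 (t : R) : 0 < t ->
  N (fun k => indseq [:: 0%N] k + t * indseq [:: 1%N] k) <= 1 ->
  forall n, N (indseq (iota 0 n.+1)) = 1.
Proof.
move=> t0 ht; elim=> [|n IH]; first exact: (symm_unit Nsym).
have fd s : finsupp (indseq s) by exact: finsupp_indseq.
have [n1 n1E] : exists n1, n1 = n.+1 by exists n.+1.
rewrite -n1E in IH *.
apply/le_anti/andP; split; last first.
  have -> : 1 = indseq (iota 0 n1.+1) 0 by [].
  by apply: symm_coord => // i; rewrite /indseq ler0n.
(* With this factor [(M - 1) d_0] absorbs the indicator of [iota 1 n1]: it is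
   the sum of [n1] vectors [t^-1 (d_0 + t d_j)] (see [NM]). *)
pose M := 1 + n1%:R / t.
have ME : M = 1 + n1%:R / t by [].
have M1 : 1 <= M by rewrite lerDl divr_ge0 // ltW.
clearbody M.
apply: (@ler_epsM _ _ ((M + n1%:R) * n1.+1%:R)).
  by rewrite mulr_ge0 // addr_ge0 //; lra.
move=> e e0.
have [] := Nmeans (s := iota 1 n1) (t :=
  [:: 0%N]) (iota_uniq _ _) _ _ _ _ _ e0 => //.
  by rewrite n1E.
  by rewrite symm_indseq_shift.
  by rewrite (symm_unit Nsym).
move=> y [fy y0 Ny]; rewrite size_iota /= invr1 => sy yd.
have y1 k : y k <= 1 by apply: le_trans (symm_coord k fy y0) Ny.
have yin i : (0 < i <= n1)%N -> 1 - n1%:R * e <= y i.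
  move=> hi; have iin : i \in iota 1 n1 by rewrite mem_iota; lia.
  have : \sum_(i <- iota 1 n1) y i <= y i + n%:R.
    rewrite (bigD1_seq i) ?iota_uniq //= lerD2l.
    apply: le_trans (ler_sum _ (G := fun=> 1) _) _ => [j _|]; first exact: y1.
    rewrite big_const_seq iter_addr addr0 ler_nat.
    have := count_predC (pred1 i) (iota 1 n1).
    rewrite size_iota count_uniq_mem ?iota_uniq // iin.
    by rewrite (eq_count (a2 := predC (pred1 i))) //; lia.
  have : n1%:R = n%:R + 1 :> R by rewrite n1E -natr1.
  nra.
have ne0 : 0 <= n1%:R * e by rewrite mulr_ge0 ?(ltW e0).
have N0v : N (fun k => indseq [:: 0%N] k + tail n1 y k) <= 1 + n1%:R * e.
  by apply: (symm_swap_tail (j := 1)) => //; [|apply: yin]; rewrite n1E.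
have Nt j : (0 < j)%N -> N (fun k =>
  indseq [:: 0%N] k + t * indseq [:: j] k) <= 1.
  move=> j0; have := symm_perm Nsym 1 j
    (a := fun k => indseq [:: 0%N] k + t * indseq [:: 1%N] k).
  rewrite (_ : _ \o _ = fun k => indseq [:: 0%N] k + t * indseq [:: j] k);
    last first.
    apply/funext => k /=;
      rewrite /indseq !mem_seq1 !(inv_eq (transpositionK 1 j)).
    by rewrite /transposition /= (ltn_eqF j0).
  by move=> -> //; apply: finsuppD => //; exact: finsuppZ.
have NM : N (fun k =>
  n1%:R / t * indseq [:: 0%N] k + indseq (iota 1 n1) k) <= n1%:R / t.
  have -> : (fun k => n1%:R / t * indseq [:: 0%N] k + indseq (iota 1 n1) k) =
    fun k => \sum_(j <- iota 1 n1) t^-1 * (indseq [:: 0%N] k + t * indseq [:: j]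
      k).
    apply/funext => k; rewrite -mulr_sumr big_split /= -mulr_sumr mulrDr.
    rewrite mulrA mulVf ?gt_eqF // mul1r big_const_seq iter_addr addr0.
    rewrite count_predT size_iota -[indseq _ _ *+ n1]mulr_natl mulrA [_^-1 *
      _]mulrC; congr (_ + _).
    rewrite /indseq; case: (boolP (k \in _)) => kin.
      rewrite (bigD1_seq k) ?iota_uniq //= mem_head big1 ?addr0 // => j jk.
      by rewrite mem_seq1 eq_sym (negbTE jk).
    rewrite big1_seq // => j /= jin; rewrite mem_seq1; case: eqP => // kj.
    by rewrite kj jin in kin.
  have fj j : finsupp (fun k => indseq [:: 0%N] k + t * indseq [:: j] k).
    by apply: finsuppD => //; exact: finsuppZ.
  apply: le_trans (symm_sum _) _; first by move=> j _; exact: finsuppZ.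
  apply: (@le_trans _ _ (\sum_(j <- iota 1 n1) t^-1)).
    rewrite big_seq [leRHS]big_seq; apply: ler_sum => j jin.
    rewrite (symm_scale Nsym) // ?invr_ge0 ?(ltW t0) //.
    by rewrite ler_piMr ?invr_ge0 ?(ltW t0) // Nt //; move: jin;
      rewrite mem_iota; lia.
  by rewrite big_const_seq iter_addr addr0 count_predT size_iota mulr_natl.
(* In [y + M d_0] everything but [y_0] has norm at most [M], nearly. *)
have y0ge : 1 - (M + n1%:R) * e <= y 0%N.
  have low : M + 1 - M * e <= N (fun k => y k + M * indseq [:: 0%N] k).
    apply: symm_dilate => //; apply: lt_le_trans yd _; rewrite le_eqVlt.
    by apply/orP; left; apply/eqP; congr N; apply/funext => k; rewrite mul1r.
  have : N (fun k => y k + M * indseq [:: 0%N] k) <=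
         (1 + n1%:R * e) + (y 0%N + n1%:R / t).
    have f1 : finsupp (fun k => indseq [:: 0%N] k + tail n1 y k).
      by apply: finsuppD => //; exact: finsupp_tail.
    have f2 : finsupp (fun k => y 0%N * indseq [:: 0%N] k) by exact: finsuppZ.
    have f3 : finsupp (fun k =>
      n1%:R / t * indseq [:: 0%N] k + indseq (iota 1 n1) k).
      by apply: finsuppD => //; exact: finsuppZ.
    have f23 := finsuppD f2 f3.
    apply: le_trans (symm_mono Nsym (finsuppD f1 f23) _) _.
      move=> k /=; have := y0 k; have := y1 k; have := y0 0%N.
      rewrite /tail /indseq mem_seq1 ME => ? ? ?.
      have -> : (k \in iota 1 n1) = (0 < k <= n1)%N by rewrite mem_iota.
      have nt0 : 0 <= n1%:R / t by rewrite ME in M1; lra.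
      apply/andP.
      case: (eqVneq k 0%N) => [->|k0] /=; first by rewrite ?ltn0 /=; split; lra.
      case: (ltnP n1 k) => kn; rewrite ?mulr0 ?addr0 ?add0r /=.
        by rewrite andbF /=; split; lra.
      by rewrite lt0n k0 /=; split; lra.
    apply: le_trans (symm_tri Nsym f1 f23) (lerD N0v _).
    apply: le_trans (symm_tri Nsym f2 f3) (lerD _ NM).
    by rewrite (symm_scale Nsym) // (symm_unit Nsym) mulr1.
  rewrite ME in low *; lra.
set K := (M + n1%:R) * e in y0ge.
have K0 : 0 <= K.
  by rewrite /K; apply: mulr_ge0; [have := ler0n R n1; lra|exact: ltW].
have hI := symm_indseq_le (iota 0 n1.+1); rewrite size_iota in hI.
rewrite mulrAC -/K;
  apply: le_trans (_ : 1 + K * N (indseq (iota 0 n1.+1)) <= _).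
  rewrite -(symm_scale Nsym) //; apply: le_trans (lerD Ny (lexx _)).
  apply: le_trans (symm_tri Nsym fy _); last exact: finsuppZ.
  apply: (symm_mono Nsym); first by apply: finsuppD => //; exact: finsuppZ.
  move=> k; rewrite /indseq mem_iota; case: ltnP => kn /=;
    last by have := y0 k; lra.
  have := yin k; have : n1%:R * e <= K by rewrite /K ler_pM2r //; lra.
  case: (eqVneq k 0%N) => [->|k0]; first by lra.
  by rewrite lt0n k0 -ltnS kn => ? /(_ isT) ?; lra.
by rewrite lerD2l ler_wpM2l.
Qed.

(** The case where unit vectors are exposed points of the unit ball. The
   induction step takes the coordinate 0, and the mean of the [n1] next unit
   vectors as target. *)
Lemma symm_exposed_l1 :
  (forall t : R, 0 < t -> 1 < N (fun k =>
    indseq [:: 0%N] k + t * indseq [:: 1%N] k)) ->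
  forall n, N (indseq (iota 0 n)) = n%:R.
Proof.
have fd s : finsupp (indseq s) by exact: finsupp_indseq.
move=> ht; elim=> [|n IH].
  apply/le_anti/andP; split; first exact: (symm_indseq_le [::]).
  by apply: symm_ge0 => // i; rewrite /indseq ler0n.
case: n IH => [_|n]; first exact: (symm_unit Nsym).
have [n1 n1E] : exists n1, n1 = n.+1 by exists n.+1.
have n1R : n1%:R = n%:R + 1 :> R by rewrite n1E natr1.
rewrite -n1E => IH; apply/le_anti/andP; split.
  by have := symm_indseq_le (iota 0 n1.+1); rewrite size_iota.
have nR : 0 <= n%:R :> R by exact: ler0n.
rewrite -natr1; apply: (@ler_epsM _ _ (3 * n1%:R + 1)); first by lra.
move=> d d0; have gap := ht d d0.
set g := N _ in gap; pose e := Order.min d ((g - 1) / 2).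
have e0 : 0 < e by rewrite lt_min d0 /=; lra.
have ed : e <= d by rewrite ge_min lexx.
have eg : 1 + e < g.
  have : e <= (g - 1) / 2 by rewrite ge_min lexx orbT.
  lra.
clearbody e; have [] := Nmeans (s := [:: 0%N]) (t :=
  iota 1 n1) _ (iota_uniq _ _) _ _ _ _ e0 => //.
- by rewrite n1E.
- exact: (symm_unit Nsym).
- by rewrite symm_indseq_shift size_iota.
move=> y [fy y0 Ny]; rewrite size_iota /= big_seq1 mul1r => y0e yd.
have y01 : y 0%N <= 1 by apply: le_trans (symm_coord 0 fy y0) Ny.
have yj j : (0 < j)%N -> y j <= d.
  move=> j0; rewrite leNgt; apply/negP => dy.
  have : g <= N (fun k => y k + e * indseq [:: 0%N] k).
    have f2 : finsupp (fun k => indseq [:: 0%N] k + d * indseq [:: 1%N] k).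
      by apply: finsuppD => //; exact: finsuppZ.
    rewrite /g -(symm_perm Nsym 1 j) //; apply: (symm_mono Nsym).
      by apply: finsuppD => //; exact: finsuppZ.
    move=> k /=; have yk := y0 k.
    rewrite /indseq !mem_seq1 /transposition.
    case: (eqVneq k 1%N) => [->|k1].
      rewrite (gtn_eqF j0) /=; case: eqP => [j1|_] /=; last by have := y0 1%N;
        lra.
      by rewrite j1 in dy; lra.
    case: (eqVneq k j) => [kj|kj].
      by rewrite kj (gtn_eqF j0) /=; lra.
    by rewrite (negbTE k1); case: (eqVneq k 0%N) => [k00|_] /=; rewrite ?k00;
      lra.
  apply/negP; rewrite -ltNge; apply: le_lt_trans eg.
  apply: le_trans (symm_tri Nsym fy _) _; first exact: finsuppZ.
  rewrite (symm_scale Nsym) ?(ltW e0) // (symm_unit Nsym); lra.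
have N1v : N (fun k => indseq [:: 1%N] k + tail n1 y k) <= 1 + e.
  by apply: (symm_swap_tail (j := 0)); rewrite ?n1E // ltW.
(* The factor 2 leaves one copy of the indicator of [iota 1 n1] for that of
   [iota 0 n1.+1], and one unit vector for the tail of [y]. *)
have low : 2 * n1%:R + 1 - 2 * n1%:R * e <=
    N (fun k => y k + 2 * indseq (iota 1 n1) k).
  have fm : finsupp (fun k => n1%:R^-1 * indseq (iota 1 n1) k)
    by exact: finsuppZ.
  have := symm_dilate (c := 2 * n1%:R) fy y0 fm Ny yd.
  have -> : (fun k => y k + 2 * n1%:R * (n1%:R^-1 * indseq (iota 1 n1) k)) =
            fun k => y k + 2 * indseq (iota 1 n1) k.
    apply/funext => k; congr (_ + _); rewrite -mulrA mulVKf //.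
    by rewrite n1E pnatr_eq0.
  by apply; lra.
have f1 : finsupp (fun k => indseq [:: 1%N] k + tail n1 y k).
  by apply: finsuppD => //; exact: finsupp_tail.
have f2 : finsupp (fun k => indseq (iota 2 n) k + d * indseq (iota 1 n1) k).
  by apply: finsuppD => //; exact: finsuppZ.
have f12 := finsuppD f1 f2.
have : N (fun k => y k + 2 * indseq (iota 1 n1) k) <=
    N (indseq (iota 0 n1.+1)) + ((1 + e) + (n%:R + d * n1%:R)).
  apply: le_trans (symm_mono Nsym (finsuppD (fd (iota 0 n1.+1)) f12) _) _.
    move=> k /=; have yk := y0 k; have yd' := yj k.
    have i0 : (k \in iota 0 n1.+1) = (k <= n1)%N by rewrite mem_iota.
    have i1 : (k \in iota 1 n1) = (0 < k <= n1)%N by rewrite mem_iota.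
    have i2 : (k \in iota 2 n) = (1 < k <= n1)%N by rewrite mem_iota n1E.
    rewrite /tail /indseq i0 i1 i2 mem_seq1.
    apply/andP; case: (ltnP n1 k) => kn.
      rewrite !andbF; have -> : (k == 1%N) = false
        by apply/gtn_eqF/(leq_trans _ kn); rewrite n1E.
      by split => /=; lra.
    have -> : (1 < k)%N = (0 < k)%N && (k != 1%N)
      by rewrite ltn_neqAle eq_sym andbC.
    case: (posnP k) => [k0|k0].
      by rewrite k0 in yk *; split => /=; lra.
    by have := yd' k0; case: (k == 1%N) => /= ?; split; lra.
  apply: le_trans (symm_tri Nsym _ f12) _ => //; rewrite lerD2l.
  apply: le_trans (symm_tri Nsym f1 f2) (lerD N1v _).
  apply: le_trans (symm_tri Nsym _ _) (lerD _ _) => //; first exact: finsuppZ.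
    by have := symm_indseq_le (iota 2 n); rewrite size_iota.
  rewrite (symm_scale Nsym) ?(ltW d0) // ler_wpM2l ?(ltW d0) //.
  by rewrite symm_indseq_shift IH.
have : n1%:R * e <= n1%:R * d by rewrite ler_wpM2l // ler0n.
move: low; move: (N _) (N _) => p q; lra.
Qed.

Lemma symm_dichotomy : (forall n, N (indseq (iota 0 n.+1)) = 1) \/
  (forall n, N (indseq (iota 0 n)) = n%:R).
Proof.
case: (pselect (exists2 t : R, 0 < t &
  N (fun k => indseq [:: 0%N] k + t * indseq [:: 1%N] k) <= 1)) => [[t t0 h]|h].
  by left; exact: symm_flat_c0 h.
right; apply: symm_exposed_l1 => t t0; rewrite ltNge; apply/negP => ht.
by apply: h; exists t.
Qed.

End SymmetricNorms.

(** * Reading the norms of a scalar field in the reals *)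

(** [rmod] is the modulus, as a real number. The last field is compactness of
   the unit circle;
     stated for Lipschitz functions it does not mention the topology
   of [K]. *)
Record norm_values (R : realType) (K : numFieldType) := {
  emb : {rmorphism R -> K} ;
  rmod : K -> R ;
  emb_le : {mono emb : r s / r <= s} ;
  emb_rmod : forall a, emb (rmod a) = `|a| ;
  circle_max : forall (g : K -> R) (L : R),
    (forall a b, `|g a - g b| <= L * rmod (a - b)) ->
    exists2 theta, rmod theta = 1 & forall eta, rmod eta = 1 ->
      g eta <= g theta }.

Section NormValues.
Variables (R : realType) (K : numFieldType) (V : norm_values R K).
Local Notation emb := (emb V).
Local Notation rmod := (rmod V).
Local Notation emb_le := (emb_le V).
Local Notation emb_rmod := (emb_rmod V).

Lemma emb_inj : injective emb.
Proof. exact: fmorph_inj. Qed.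

Lemma emb_lt : {mono emb : r s / r < s}.
Proof. by move=> r s; rewrite !lt_neqAle (inj_eq emb_inj) emb_le. Qed.

Lemma emb_ge0 r : (0 <= emb r) = (0 <= r).
Proof. by rewrite -[X in X <= _](rmorph0 emb) emb_le. Qed.

Lemma rmod_ge0 a : 0 <= rmod a.
Proof. by rewrite -emb_ge0 emb_rmod normr_ge0. Qed.

Lemma rmod_norm a : rmod `|a| = rmod a.
Proof. by apply: emb_inj; rewrite !emb_rmod normr_id. Qed.

Lemma rmod_emb r : 0 <= r -> rmod (emb r) = r.
Proof. by move=> r0; apply: emb_inj; rewrite emb_rmod ger0_norm // emb_ge0. Qed.

Lemma rmod_embE r : rmod (emb r) = `|r|.
Proof.
have [r0|/ltW r0] := leP 0 r; first by rewrite rmod_emb // ger0_norm.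
apply: emb_inj; rewrite emb_rmod ler0_norm ?ler0_norm ?rmorphN //.
by rewrite -(rmorph0 emb) emb_le.
Qed.

Lemma ge0_emb a : 0 <= a -> a = emb (rmod a).
Proof. by move=> a0; rewrite emb_rmod ger0_norm. Qed.

Lemma rmod0 : rmod 0 = 0.
Proof. by apply: emb_inj; rewrite emb_rmod normr0 rmorph0. Qed.

Lemma rmod1 : rmod 1 = 1.
Proof. by apply: emb_inj; rewrite emb_rmod normr1 rmorph1. Qed.

Lemma rmodM a b : rmod (a * b) = rmod a * rmod b.
Proof. by apply: emb_inj; rewrite rmorphM !emb_rmod normrM. Qed.

Lemma rmodN a : rmod (- a) = rmod a.
Proof. by apply: emb_inj; rewrite !emb_rmod normrN. Qed.

Lemma rmodD a b : rmod (a + b) <= rmod a + rmod b.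
Proof. by rewrite -emb_le rmorphD !emb_rmod ler_normD. Qed.

Lemma rmod_eq0 a : (rmod a == 0) = (a == 0).
Proof. by rewrite -(inj_eq emb_inj) emb_rmod rmorph0 normr_eq0. Qed.

Lemma rmod_sum (I : Type) (r : seq I) (P : pred I) (F : I -> K) :
  rmod (\sum_(i <- r | P i) F i) <= \sum_(i <- r | P i) rmod (F i).
Proof.
elim/big_rec2: _ => [|i y x _ h]; first by rewrite rmod0.
by apply: le_trans (rmodD _ _) _; rewrite lerD2l.
Qed.

Lemma phase a : exists2 u, rmod u = 1 & u * a = emb (rmod a).
Proof.
have [->|a0] := eqVneq a 0; first by exists 1;
  rewrite ?rmod1 // mulr0 rmod0 rmorph0.
exists (`|a| / a); last by rewrite emb_rmod divfK.
by apply: emb_inj;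
  rewrite emb_rmod normrM normfV normr_id divff ?normr_eq0 // rmorph1.
Qed.

(** An upper bound in [K] of a nonempty set of real numbers is itself real, so
   that suprema in [K] and in [R] agree. *)
Lemma ksup_emb (S : set R) : S !=set0 -> has_ubound S ->
  ksup (emb @` S) = emb (sup S).
Proof.
move=> [s Ss] bS; rewrite /ksup /supremum; case: ifPn => [/eqP S0|_].
  by have : (set0 : set K) (emb s) by rewrite -S0; exists s.
apply: xget_subset1; last exact: is_subset1_supremums.
split=> [_ [r Sr <-]|m hm]; first by rewrite emb_le; apply: ub_le_sup.
have sm : emb s <= m by apply: hm; exists s.
have mE : m = emb (rmod (m - emb s) + s).
  by rewrite rmorphD -ge0_emb ?subr_ge0 // subrK.
rewrite mE emb_le; apply: ge_sup; first by exists s.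
by move=> r Sr; rewrite -emb_le -mE; apply: hm; exists r.
Qed.

Definition rnorm (E : normedModType K) (x : E) : R := rmod `|x|.

Section Norm.
Variable E : normedModType K.
Implicit Types x y : E.

Lemma rnormE x : emb (rnorm x) = `|x|.
Proof. by rewrite emb_rmod normr_id. Qed.

Lemma rnorm_ge0 x : 0 <= rnorm x. Proof. exact: rmod_ge0. Qed.

Lemma rnorm_le x y : (rnorm x <= rnorm y) = (`|x| <= `|y|).
Proof. by rewrite -emb_le !rnormE. Qed.

Lemma rnorm_leE x r : (rnorm x <= r) = (`|x| <= emb r).
Proof. by rewrite -emb_le rnormE. Qed.

Lemma rnormD x y : rnorm (x + y) <= rnorm x + rnorm y.
Proof. by rewrite rnorm_leE rmorphD !rnormE ler_normD. Qed.

Lemma rnormN x : rnorm (- x) = rnorm x. Proof. by rewrite /rnorm normrN. Qed.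

Lemma rnormB x y : rnorm (x - y) = rnorm (y - x).
Proof. by rewrite -rnormN opprB. Qed.

Lemma rnormZ a x : rnorm (a *: x) = rmod a * rnorm x.
Proof. by rewrite /rnorm normrZ rmodM rmod_norm. Qed.

Lemma rnorm0 : rnorm (0 : E) = 0. Proof. by rewrite /rnorm normr0 rmod0. Qed.

Lemma rnorm_eq0 x : (rnorm x == 0) = (x == 0).
Proof. by rewrite /rnorm rmod_eq0 normr_eq0. Qed.

Lemma rnorm_sub x y : rnorm x <= rnorm y + rnorm (x - y).
Proof. by have := rnormD y (x - y); rewrite addrC subrK. Qed.

Lemma rnorm_sum (I : Type) (r : seq I) (P : pred I) (F : I -> E) :
  rnorm (\sum_(i <- r | P i) F i) <= \sum_(i <- r | P i) rnorm (F i).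
Proof.
elim/big_rec2: _ => [|i y x _ h]; first by rewrite rnorm0.
by apply: le_trans (rnormD _ _) _; rewrite lerD2l.
Qed.

Lemma cvg_rnormP (u : nat -> E) (l : E) : u @ \oo --> l <->
  forall e, 0 < e -> exists N, forall n, (N <= n)%N -> rnorm (l - u n) < e.
Proof.
split=> [/cvgrPdist_lt h e e0|h].
  have /h[N _ hN] : 0 < emb e by rewrite -(rmorph0 emb) emb_lt.
  by exists N => n Nn; rewrite -emb_lt rnormE; apply: hN.
apply/cvgrPdist_lt => e e0; have e1 : 0 < rmod e.
  by rewrite -emb_lt emb_rmod rmorph0 normr_gt0 gt_eqF.
have [N hN] := h _ e1; exists N => // n /= Nn.
by rewrite -rnormE (ge0_emb (ltW e0)) emb_lt; apply: hN.
Qed.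

End Norm.

Lemma rnorm_scalar (a : K^o) : rnorm a = rmod a. Proof. exact: rmod_norm. Qed.

Lemma cauchy_rnorm_cvg (E : completeNormedModType K) (u : nat -> E) :
  (forall e, 0 < e -> exists N, forall m n, (N <= m)%N -> (m <= n)%N ->
     rnorm (u n - u m) < e) ->
  exists l : E, u @ \oo --> l.
Proof.
move=> h; have /cauchy_cvgP cu : cauchy (u @ \oo).
  apply/cauchy_ballP => e e0; have e1 : 0 < rmod e.
    by rewrite -emb_lt emb_rmod rmorph0 normr_gt0 gt_eqF.
  have [N hN] := h _ e1.
  pose A := [set u n | n in [set n | (N <= n)%N]].
  have FA : (u @ \oo) A by exists N => // n Nn; exists n.
  exists (A, A) => //= -[_ _] /= [[i Ni <-] [j Nj <-]].
  rewrite -ball_normE /= (ge0_emb (ltW e0)) -rnormE emb_lt.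
  by case: (leqP i j) => ij; [rewrite rnormB|]; apply: hN => //; apply: ltnW.
by exists (lim (u @ \oo)).
Qed.

(** * Operator norms *)

Section Operators.
Variables E F : normedModType K.

Lemma continuous_rnorm_bounded (T : {linear E -> F}) : continuous T ->
  exists M, forall x, rnorm (T x) <= M * rnorm x.
Proof.
move=> cT; have hB := iffRL (linear_bounded_continuous T) cT.
have hT := iffLR (linear_boundedP T) hB.
have [M M0 hM] := pinfty_ex_gt0 hT.
by exists (rmod M) => x; rewrite rnorm_leE rmorphM -(ge0_emb (ltW M0)) rnormE;
  apply: hM.
Qed.

Lemma rnorm_bounded_continuous (T : {linear E -> F}) M :
  (forall x, rnorm (T x) <= M * rnorm x) -> continuous T.
Proof.
move=> hM; apply: (iffLR (linear_bounded_continuous T)).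
apply: (iffRL (linear_boundedP T)).
exists (emb `|M|); split; first by rewrite realE emb_ge0 normr_ge0.
move=> r Mr x; apply: le_trans (_ : emb (`|M|) * `|x| <= _).
  rewrite -(rnormE x) -rmorphM -rnorm_leE (le_trans (hM x)) //.
  by rewrite ler_wpM2r ?rnorm_ge0 // ler_norm.
by rewrite ler_wpM2r // ltW.
Qed.

Definition ropnorm (T : E ->
  F) : R := sup [set rnorm (T x) | x in [set x | rnorm x <= 1]].

Section BoundedOn.
Variables (T : E -> F) (M : R).
Hypothesis TM : forall x, rnorm x <= 1 -> rnorm (T x) <= M.

Lemma has_sup_ropnorm : has_sup [set rnorm (T x) | x in [set x | rnorm x <= 1]].
Proof.
split; first by exists (rnorm (T 0)); exists 0 => //=; rewrite rnorm0.
by exists M => _ [x /= x1 <-]; apply: TM.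
Qed.

Lemma opnorm_ropnorm : opnorm T = emb (ropnorm T).
Proof.
have [S0 bS] := has_sup_ropnorm; rewrite -ksup_emb //; congr ksup.
apply/seteqP; split=> [_ [x /= x1 <-]|_ [_ [x /= x1 <-] <-]].
  by exists (rnorm (T x)); rewrite ?rnormE //; exists x;
    rewrite //= rnorm_leE rmorph1.
by exists x; rewrite ?rnormE //= -(rmorph1 emb) -rnorm_leE.
Qed.

Lemma ropnorm_ub x : rnorm x <= 1 -> rnorm (T x) <= ropnorm T.
Proof. by move=> x1; apply: ub_le_sup; [case: has_sup_ropnorm|exists x]. Qed.

Lemma ropnorm_le : ropnorm T <= M.
Proof.
by apply: ge_sup; [case: has_sup_ropnorm|move=> _ [x /= x1 <-]; apply: TM].
Qed.

Lemma ropnorm_adherent e : 0 < e ->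
  exists2 x, rnorm x <= 1 & ropnorm T - e < rnorm (T x).
Proof.
by move=> e0; have [_ [x /= x1 <-] h] := sup_adherent e0 has_sup_ropnorm;
  exists x.
Qed.

End BoundedOn.

Section LinearBounded.
Variable T : {linear E -> F}.
Hypothesis cT : continuous T.

Lemma continuous_ball_bounded : exists M, forall x, rnorm x <= 1 ->
  rnorm (T x) <= M.
Proof.
have [M hM] := continuous_rnorm_bounded cT; exists `|M| => x x1.
rewrite (le_trans (hM x)) // -[leRHS]mulr1.
by rewrite (le_trans (ler_wpM2r (rnorm_ge0 x) (ler_norm M))) // ler_wpM2l.
Qed.

Lemma ropnorm_rnorm x : rnorm (T x) <= ropnorm T * rnorm x.
Proof.
have [M hM] := continuous_ball_bounded.
have [->|x0] := eqVneq x 0; first by rewrite linear0 !rnorm0 mulr0.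
have nx0 : 0 < rnorm x by rewrite lt_neqAle rnorm_ge0 eq_sym rnorm_eq0 x0.
have mV : rmod (emb (rnorm x)^-1) = (rnorm x)^-1
  by rewrite rmod_emb // invr_ge0 ltW.
have := ropnorm_ub hM (x := emb (rnorm x)^-1 *: x).
rewrite linearZ !rnormZ mV mulVf ?gt_eqF // => /(_ (lexx _)).
by rewrite mulrC ler_pdivrMr.
Qed.

Lemma ropnorm_ge0 : 0 <= ropnorm T.
Proof.
have [M hM] := continuous_ball_bounded.
by apply: le_trans (ropnorm_ub hM (x := 0) _); rewrite ?rnorm_ge0 // rnorm0.
Qed.

End LinearBounded.

Lemma opnorm_attained (T : E -> F) r : (forall x, rnorm x <= 1 ->
  rnorm (T x) <= r) ->
  (exists2 x, rnorm x <= 1 & rnorm (T x) = r) -> opnorm T = emb r.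
Proof.
move=> Tr [x x1 Tx]; rewrite (opnorm_ropnorm Tr); congr (emb _).
apply/le_anti; rewrite (ropnorm_le Tr) /= -{1}Tx; exact: (ropnorm_ub Tr).
Qed.

End Operators.

(** * Numerical index one and the alternative Daugavet property *)

Section Indices.
Variable E : normedModType K.
Implicit Type T : {linear E -> E}.

Definition numerical_approx (T : E -> E) := forall e, 0 < e ->
  exists (x : E) (phi : {linear E -> K^o}),
    [/\ `|x| = 1, continuous phi, opnorm phi = 1, phi x = 1
      & ropnorm T - e < rmod (phi (T x))].

(** The alternative Daugavet property without attainment of the maximum. *)
Definition daugavet_approx := forall T, continuous T -> rank_one T ->
  forall e, 0 < e -> exists theta x,
    [/\ rmod theta = 1, rnorm x <= 1
      & 1 + ropnorm T - e < rnorm (x + theta *: T x)].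

Let states T : set R := [set r | exists (x : E) (phi : {linear E -> K^o}),
  [/\ `|x| = 1, continuous phi, opnorm phi = 1, phi x = 1
    & r = rmod (phi (T x))]].

Lemma states_le T r : continuous T -> states T r -> r <= ropnorm T.
Proof.
move=> cT [x [phi [x1 cphi phi1 phix ->]]].
have [M hM] := continuous_ball_bounded cphi.
have o1 : ropnorm phi = 1 by apply: emb_inj;
  rewrite -(opnorm_ropnorm hM) phi1 rmorph1.
have nx1 : rnorm x = 1 by apply: emb_inj; rewrite rnormE x1 rmorph1.
rewrite -rnorm_scalar (le_trans (ropnorm_rnorm cphi _)) // o1 mul1r.
by rewrite (le_trans (ropnorm_rnorm cT _)) // nx1 mulr1.
Qed.

Lemma numerical_radius_states T : continuous T -> states T !=set0 ->
  numerical_radius T = emb (sup (states T)).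
Proof.
move=> cT S0; rewrite -ksup_emb //; last first.
  by exists (ropnorm T) => r; apply: states_le.
congr ksup; apply/seteqP; split.
  move=> _ [x [phi [x1 cphi phi1 phix ->]]].
  by exists (rmod (phi (T x))); rewrite ?emb_rmod //; exists x, phi.
move=> _ [_ [x [phi [x1 cphi phi1 phix ->]]] <-].
by exists x, phi; rewrite emb_rmod.
Qed.

Lemma numerical_approx_index_one :
  (forall T, continuous T -> numerical_approx T) -> numerical_index_one E.
Proof.
move=> h T cT; have [M hM] := continuous_ball_bounded cT.
have hT := h T cT.
have bS : has_ubound (states T) by exists (ropnorm T) => r; apply: states_le.
have S0 : states T !=set0.
  have [x [phi [? ? ? ? _]]] := hT 1 ltr01.
  by exists (rmod (phi (T x))), x, phi.
rewrite numerical_radius_states // (opnorm_ropnorm hM) //.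
congr (emb _); apply/le_anti/andP; split.
  by apply: ge_sup => // r; apply: states_le.
apply/ler_addgt0Pr => e e0; have [x [phi [? ? ? ? he]]] := hT e e0.
rewrite -lerBlDr (le_trans (ltW he)) //.
by apply: ub_le_sup => //; exists x, phi.
Qed.

(** Positivity of the norm of [T] provides states: without any, the numerical
   radius would be zero. *)
Lemma index_one_numerical_approx T : numerical_index_one E -> continuous T ->
  0 < ropnorm T -> numerical_approx T.
Proof.
move=> h cT T0 e e0; have [M hM] := continuous_ball_bounded cT.
have := h T cT; rewrite (opnorm_ropnorm hM).
have [S0|S0] := pselect (states T !=set0).
  rewrite numerical_radius_states // => /emb_inj sE.
  have hS : has_sup (states T).
    by split => //; exists (ropnorm T) => r; apply: states_le.
  have [_ [x [phi [x1 cphi phi1 phix ->]]]] := sup_adherent e0 hS.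
  by rewrite sE => hr; exists x, phi.
rewrite /numerical_radius /ksup (_ : [set r | _] = set0).
  by rewrite supremum0 -(rmorph0 emb) => /emb_inj T00; rewrite -T00 ltxx in T0.
apply/seteqP; split => // r [x [phi [x1 cphi phi1 phix _]]]; apply: S0.
by exists (rmod (phi (T x))), x, phi.
Qed.

Lemma numerical_approx_daugavet T : numerical_approx T ->
  forall e, 0 < e -> exists theta x,
    [/\ rmod theta = 1, rnorm x <= 1
      & 1 + ropnorm T - e < rnorm (x + theta *: T x)].
Proof.
move=> h e /h[x [phi [x1 cphi phi1 phix hx]]].
have nx1 : rnorm x = 1 by apply: emb_inj; rewrite rnormE x1 rmorph1.
have [M hM] := continuous_ball_bounded cphi.
have o1 : ropnorm phi = 1 by apply: emb_inj;
  rewrite -(opnorm_ropnorm hM) phi1 rmorph1.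
have [u u1 uE] := phase (phi (T x)).
exists u, x; split; rewrite ?nx1 //.
have := ropnorm_rnorm cphi (x + u *: T x); rewrite o1 mul1r; apply: lt_le_trans.
rewrite linearD linearZ phix /= rnorm_scalar /GRing.scale /= uE.
rewrite -(rmorph1 emb) -rmorphD rmod_emb; first by lra.
by rewrite addr_ge0 // rmod_ge0.
Qed.

Lemma ropnorm_perturbation T M : (forall x, rnorm (T x) <= M * rnorm x) ->
  forall theta x, rnorm x <= 1 ->
    rnorm (x + theta *: T x) <= 1 + rmod theta * `|M|.
Proof.
move=> hM theta x x1; rewrite (le_trans (rnormD _ _)) // lerD // rnormZ.
rewrite ler_wpM2l ?rmod_ge0 // (le_trans (hM x)) // -[leRHS]mulr1.
by rewrite (le_trans (ler_wpM2r (rnorm_ge0 x) (ler_norm M))) // ler_wpM2l.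
Qed.

(** Compactness of the circle of scalars of modulus one turns the approximate
   equality into an attained maximum. *)
Lemma daugavet_max T : continuous T ->
  (forall e, 0 < e -> exists theta x,
    [/\ rmod theta = 1, rnorm x <= 1
      & 1 + ropnorm T - e < rnorm (x + theta *: T x)]) ->
  is_max [set opnorm (fun x : E => x + theta *: T x)
           | theta in [set theta : K | `|theta| = 1]] (1 + opnorm T).
Proof.
move=> cT h; have [M hM] := continuous_ball_bounded cT.
have pT := ropnorm_perturbation (ropnorm_rnorm cT);
  rewrite (ger0_norm (ropnorm_ge0 cT)) in pT.
pose g theta := ropnorm (fun x : E => x + theta *: T x).
have g_rmod a : g a <= 1 + rmod a * ropnorm T by exact: (ropnorm_le (pT a)).
have g_ub a b : g a <= g b + ropnorm T * rmod (a - b).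
  apply: (@ropnorm_le _ _ _ (g b + ropnorm T * rmod (a - b))) => x x1.
  rewrite (le_trans (rnorm_sub _ (x + b *: T x))) // lerD //.
    by apply: (ropnorm_ub (pT b)).
  rewrite opprD addrACA subrr add0r -scalerBl rnormZ mulrC.
  by rewrite ler_wpM2r ?rmod_ge0 //; apply: (ropnorm_ub hM).
have [] := @circle_max _ _ V g (ropnorm T).
  move=> a b; rewrite ler_norml; have := g_ub a b; have := g_ub b a.
  by rewrite -(rmodN (b - a)) opprB => ? ?; apply/andP; split; lra.
move=> theta theta1 hmax.
have gE : g theta = 1 + ropnorm T.
  apply/le_anti/andP; split; first by have := g_rmod theta;
    rewrite theta1 mul1r.
  apply/ler_addgt0Pr => e /h[eta [x [eta1 x1 hx]]].
  have := hmax eta eta1; have := ropnorm_ub (pT eta) x1.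
  rewrite -/(g eta); lra.
have opE a : opnorm (fun x : E => x + a *: T x) = emb (g a).
  exact: (opnorm_ropnorm (pT a)).
rewrite (opnorm_ropnorm hM) -(rmorph1 emb) -rmorphD -gE; split.
  by exists theta; rewrite ?opE //= -emb_rmod theta1 rmorph1.
move=> _ [eta /= eta1 <-]; rewrite opE emb_le; apply: hmax.
by apply: emb_inj; rewrite emb_rmod eta1 rmorph1.
Qed.

Lemma rank_one_ropnorm_gt0 T : continuous T -> rank_one T -> 0 < ropnorm T.
Proof.
move=> cT [y y0 rT]; have [x _ Tx] : range T y by rewrite rT; exists 1;
  rewrite ?scale1r.
rewrite lt_neqAle ropnorm_ge0 // andbT eq_sym; apply: contraNN y0 => /eqP T0.
by have := ropnorm_rnorm cT x;
  rewrite T0 mul0r Tx -rnorm_eq0 eq_le rnorm_ge0 => ->.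
Qed.

Lemma index_one_daugavet : numerical_index_one E -> alternative_Daugavet E.
Proof.
move=> h T cT rT; apply: daugavet_max => //; apply: numerical_approx_daugavet.
by apply: index_one_numerical_approx => //; exact: rank_one_ropnorm_gt0.
Qed.

Lemma alternative_daugavet_approx : alternative_Daugavet E -> daugavet_approx.
Proof.
move=> h T cT rT e e0; have [M hM] := continuous_ball_bounded cT.
have [[theta /= theta1 oE] _] := h T cT rT.
have pT := ropnorm_perturbation (ropnorm_rnorm cT) theta.
have [x x1 hx] := ropnorm_adherent pT e0.
exists theta, x; split => //; first by apply: emb_inj;
  rewrite emb_rmod theta1 rmorph1.
suff <- : ropnorm (fun x : E => x + theta *: T x) = 1 + ropnorm T by [].
apply: emb_inj; rewrite -(opnorm_ropnorm pT) oE rmorphD rmorph1.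
by rewrite (opnorm_ropnorm hM).
Qed.

End Indices.

End NormValues.

(** * Sequences *)

Section Sequences.
Variables (R : realType) (K : numFieldType) (V : norm_values R K).
Local Notation emb := (emb V).
Local Notation rmod := (rmod V).
Local Notation rnorm := (rnorm V).
Local Notation emb_rmod := (emb_rmod V).
Local Notation emb_le := (emb_le V).
Implicit Type f : nat -> K^o.

Lemma series_norm_emb f n :
  [series (`|f k| : K^o)]_k n = emb (\sum_(0 <= k < n) rmod (f k)).
Proof.
rewrite rmorph_sum; apply: eq_bigr => k _; exact: esym (emb_rmod _).
Qed.

Lemma l1_cvg f s : [series (`|f k| : K^o)]_k @ \oo --> (emb s : K^o) ->
  l1 f /\ l1norm f = emb s.
Proof.
move=> h; split; first by apply/cvg_ex; exists (emb s).
exact: (cvg_lim _ h).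
Qed.

Lemma l1_finsupp f n : (forall k, (n <= k)%N -> f k = 0) ->
  l1 f /\ l1norm f = emb (\sum_(0 <= k < n) rmod (f k)).
Proof.
move=> fn; apply: l1_cvg; apply/(cvg_rnormP V) => e e0; exists n => m nlem.
rewrite series_norm_emb (big_cat_nat (leq0n n) nlem) //=.
rewrite [X in emb (_ + X)]big1_seq ?addr0 ?subrr ?rnorm0 //.
by move=> k; rewrite mem_index_iota => /andP[_ /andP[nk _]];
  rewrite fn // rmod0.
Qed.

Lemma supnorm_sup f M : (forall n, rmod (f n) <= M) ->
  supnorm f = emb (sup [set rmod (f n) | n in [set: nat]]).
Proof.
move=> fM; rewrite -ksup_emb.
- congr ksup; apply/seteqP; split=> [_ [n _ <-]|_ [_ [n _ <-] <-]].
    by exists (rmod (f n)); [exists n|rewrite emb_rmod].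
  by exists n; rewrite ?emb_rmod.
- by exists (rmod (f 0%N)); exists 0%N.
- by exists M => _ [n _ <-].
Qed.

Lemma linear_pack (E F : normedModType K) (T : E -> F) : linear T ->
  exists T' : {linear E -> F}, forall x, T' x = T x.
Proof.
move=> lT; pose m := GRing.isLinear.Build _ _ _ _ T lT.
by pose T' : {linear E -> F} := HB.pack T m; exists T'.
Qed.

End Sequences.

(** * Rearrangement invariant spaces *)

Section Kothe.
Variables (R : realType) (K : numFieldType) (V : norm_values R K).
Variables (E : completeNormedModType K) (X : {linear E -> (nat -> K^o)}).
Hypothesis ri : rearrangement_invariant X.
Local Notation emb := (emb V).
Local Notation rmod := (rmod V).
Local Notation rnorm := (rnorm V).
Local Notation emb_rmod := (emb_rmod V).
Local Notation emb_le := (emb_le V).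
Implicit Types (x y : E) (f : nat -> K^o) (a b : nat -> R).

Let Xinj : injective X := kothe_inj (ri_kothe ri).

Lemma coordD x y n : X (x + y) n = (X x n : K) + X y n.
Proof. by rewrite linearD. Qed.

Lemma coordZ c x n : X (c *: x) n = c * (X x n : K).
Proof. by rewrite linearZ. Qed.

Lemma coordN x n : X (- x) n = - (X x n : K).
Proof. by rewrite linearN. Qed.

Lemma coord_le x n : rmod (X x n) <= rnorm x.
Proof.
have [[M fM] fx] := ri_linfty ri x.
have M0 : 0 <= M by apply: le_trans (fM 0%N).
have fM' k : rmod (X x k) <= rmod M.
  by rewrite -emb_le emb_rmod -(ge0_emb _ M0); apply: fM.
move: fx; rewrite (supnorm_sup fM') -(rnormE V) emb_le; apply: le_trans.
by apply: ub_le_sup; [exists (rmod M) => _ [k _ <-]|exists n].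
Qed.

Lemma rnorm_mono x y : (forall n, rmod (X x n) <= rmod (X y n)) ->
  rnorm x <= rnorm y.
Proof.
move=> h; have [|z Xz zy] := kothe_ideal (ri_kothe ri) (f := X x) (y := y).
  by move=> n; rewrite -!emb_rmod emb_le.
by rewrite rnorm_le -(Xinj Xz).
Qed.

Definition of_seq f : E := xget 0 [set x | X x = f].

Lemma of_seqK f : range X f -> X (of_seq f) = f.
Proof. by move=> [x _ Xx]; apply: (xgetI 0 (P := [set x | X x = f]) Xx). Qed.

Lemma range_finsupp f n : (forall k, (n <= k)%N -> f k = 0) -> range X f.
Proof.
by move=> /(l1_finsupp V)[l1f _]; have [x Xx _] := ri_l1 ri l1f; exists x.
Qed.

Definition restr (p : pred nat) x := of_seq (fun n => if p n then X x n else 0).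

Lemma coord_restr p x n : X (restr p x) n = if p n then X x n else 0.
Proof.
rewrite of_seqK //.
have [|z Xz _] := kothe_ideal (ri_kothe ri)
    (f := fun n => if p n then X x n else 0) (y := x).
  by move=> k; case: ifP => // _; rewrite normr0.
by exists z.
Qed.

Lemma rnorm_restr p x : rnorm (restr p x) <= rnorm x.
Proof.
by apply: rnorm_mono => n; rewrite coord_restr; case: ifP;
  rewrite ?rmod0 ?rmod_ge0.
Qed.

Lemma restrB p x y : restr p (x - y) = restr p x - restr p y.
Proof.
apply: Xinj; apply/funext => n.
rewrite coordD coordN !coord_restr coordD coordN.
by case: ifP => //; rewrite subr0.
Qed.

Definition trunc n := restr (fun k => (k < n)%N).

Definition of_real a : E := of_seq (fun n => emb (a n)).

Lemma coord_of_real a n : finsupp a -> X (of_real a) n = emb (a n).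
Proof.
move=> [m am]; rewrite of_seqK //; apply: (range_finsupp (n := m)) => k mk.
by rewrite am // rmorph0.
Qed.

Definition real_norm a := rnorm (of_real a).

Lemma real_norm_symmetric : symmetric_norm real_norm.
Proof.
split=> [a b fa fb|c a fa c0|a b fb ab|i j a fa|i].
- rewrite /real_norm (_ : of_real _ = of_real a + of_real b) ?rnormD //.
  apply: Xinj; apply/funext => n.
  by rewrite coordD !coord_of_real ?rmorphD //; apply: finsuppD.
- rewrite /real_norm (_ : of_real _ = emb c *: of_real a) ?rnormZ ?rmod_emb //.
  apply: Xinj; apply/funext => n.
  by rewrite coordZ !coord_of_real ?rmorphM //; apply: finsuppZ.
- apply: rnorm_mono => n; have /andP[a0 anb] := ab n.
  rewrite !coord_of_real ?rmod_emb // ?(le_trans a0) //.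
  apply: finsupp_mono fb _ => k bk; have := ab k.
  by rewrite bk => ?; apply: le_anti; rewrite andbC.
- have tK := transpositionK i j; have [m am] := fa.
  have [|la _] := @l1_finsupp _ _ V (X (of_real a)) m.
    by move=> k mk; rewrite coord_of_real // am // rmorph0.
  have [_ /(_ _ _ erefl)h] := ri_perm ri tK tK la.
  apply/esym; congr (rmod _); apply: h; apply/funext => n /=.
  by rewrite !coord_of_real //; exact: finsupp_transposition.
- have fi := finsupp_indseq R [:: i].
  apply/le_anti/andP; split; last first.
    have := coord_le (of_real (indseq R [:: i])) i.
    by rewrite coord_of_real // /indseq mem_head rmorph1 rmod1.
  have [|l1f nf] := @l1_finsupp _ _ V (X (of_real (indseq R [:: i]))) i.+1.
    move=> k ik; rewrite coord_of_real // /indseq mem_seq1 gtn_eqF //.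
    by rewrite rmorph0.
  have [x Xx] := ri_l1 ri l1f; rewrite (Xinj Xx) nf -(rnormE V) emb_le.
  rewrite big_nat_recr //= big1_seq.
    by rewrite add0r coord_of_real // /indseq mem_head rmorph1 rmod1.
  move=> k /=; rewrite mem_index_iota => /andP[_ ki].
  by rewrite coord_of_real // /indseq mem_seq1 ltn_eqF // rmorph0 rmod0.
Qed.


Lemma rnorm_trunc_le x M n : 0 <= M -> (forall k, rmod (X x k) <= M) ->
  rnorm (trunc n x) <= M * real_norm (indseq R (iota 0 n)).
Proof.
move=> M0 xM; have fi := finsupp_indseq R (iota 0 n).
rewrite -(symm_scale real_norm_symmetric) //; apply: rnorm_mono => k.
rewrite coord_of_real; last exact: finsuppZ.
rewrite coord_restr rmod_emb /indseq mem_iota ?mulr_ge0 ?ler0n //.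
by case: ltnP => kn; rewrite ?rmod0 ?mulr0 // mulr1.
Qed.

(** The blocks come from choosing repeatedly, after the end of one interval, the
   next interval that witnesses the failure of the Cauchy property. *)
Lemma trunc_blocks x e : 0 < e -> ~ (exists N, forall m n,
    (N <= m)%N -> (m <= n)%N -> rnorm (trunc n x - trunc m x) < e) ->
  exists a b : nat -> nat, (forall k, b k <= a k.+1)%N /\
    forall k, e <= rnorm (restr (fun j => a k <= j < b k)%N x).
Proof.
move=> e0 h.
have step N : exists mn : nat * nat, (N <= mn.1)%N /\
    e <= rnorm (restr (fun j => mn.1 <= j < mn.2)%N x).
  apply: contra_notP h => hN; exists N => m n Nm mn; rewrite ltNge.
  apply/negP => he; apply: hN; exists (m, n); split => //=.
  apply: le_trans he _; apply: rnorm_mono => k.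
  rewrite coordD coordN !coord_restr.
  case: (ltnP k m) => km;
    first by rewrite (leq_trans km mn) subrr rmod0 ?rmod_ge0.
  by rewrite subr0.
have [c cP] := choice step.
pose s := fix s k := if k is k'.+1 then (c (s k')).2 else 0%N.
exists (fun k => (c (s k)).1), (fun k => (c (s k)).2); split=> k.
  by have [] := cP (s k.+1).
by have [] := cP (s k).
Qed.

Lemma rnorm_restr_sub p x y : rnorm (restr p x - restr p y) <= rnorm (x - y).
Proof. by rewrite -restrB rnorm_restr. Qed.

(** Were the truncations of [x] not Cauchy, there would be disjoint blocks of
   [x] of norm at least [e]. Cantor's diagonal argument selects some of them:
   the block attached to a point [d] of a countable dense set is kept when [d]
   is small there and dropped when it is not, so that the sum of the kept blocks
   is at distance at least [e / 2] from every such [d]. *)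
Lemma trunc_cauchy x e : separable E -> 0 < e ->
  exists N, forall m n, (N <= m)%N -> (m <= n)%N ->
    rnorm (trunc n x - trunc m x) < e.
Proof.
move=> [D cD dD] e0; apply: contrapT => /(trunc_blocks e0)[a [b [ba hab]]].
have [g gI] := elimT (countable_injP D) cD.
pose B k j := (a k <= j < b k)%N.
have ble k : (a k <= b k)%N.
  rewrite leqNgt; apply/negP => bak; have := hab k; rewrite leNgt => /negP;
    apply.
  rewrite (_ : restr _ x = 0) ?rnorm0 //; apply: Xinj; apply/funext => j.
  rewrite coord_restr linear0; case: ifP => // /andP[h1 h2].
  by have := leq_ltn_trans h1 (ltn_trans h2 bak); rewrite ltnn.
have blt k l : (k < l)%N -> (b k <= a l)%N.
  elim: l => // l IH; rewrite ltnS leq_eqVlt => /predU1P[->//|kl].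
  exact: leq_trans (leq_trans (IH kl) (ble l)) (ba l).
have Bdisj k l j : B k j -> B l j -> k = l.
  move=> /andP[h1 h2] /andP[h3 h4]; case: (ltngtP k l) => // kl.
    by have := leq_trans h2 (leq_trans (blt _ _ kl) h3); rewrite ltnn.
  by have := leq_trans h4 (leq_trans (blt _ _ kl) h1); rewrite ltnn.
pose S := [set k | exists d, [/\ D d, g d = k & rnorm (restr (B k) d) < e / 2]].
pose p j := `[< exists2 k, S k & B k j >].
pose y := restr p x.
have yB k : restr (B k) y = if `[< S k >] then restr (B k) x else 0.
  apply: Xinj; apply/funext => j; rewrite !coord_restr.
  case: asboolP => Sk; rewrite ?linear0 ?coord_restr;
    case: (boolP (B k j)) => //.
    by move=> Bkj; case: ifP => // /asboolP[]; exists k.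
  move=> Bkj; case: ifP => // /asboolP[l Sl Blj].
  by case: Sk; rewrite (Bdisj _ _ _ Bkj Blj).
have [d [/= yd Dd]] : (ball y (emb (e / 2))) `&` D !=set0.
  have e2 : 0 < emb (e / 2) by rewrite -(rmorph0 emb) emb_lt divr_gt0.
  have [|d [yd Dd]] := dD _ _ (open_interior (ball y (emb (e / 2)))).
    by exists y; apply: nbhsx_ballx.
  by exists d; split=> //; apply: interior_subset yd.
move: yd; rewrite -ball_normE /= -(rnormE V) emb_lt => yd.
have := rnorm_restr_sub (B (g d)) y d; rewrite yB.
case: asboolP => [[d' [Dd' gd' hd']]|nS].
  have dd : d' = d by apply: gI gd'; rewrite inE.
  have := rnorm_sub V (restr (B (g d)) x) (restr (B (g d)) d);
    rewrite dd in hd'.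
  have := hab (g d); rewrite -/(B _); lra.
rewrite sub0r rnormN => h; apply: nS; exists d; split => //.
exact: le_lt_trans h yd.
Qed.


(** * Separable spaces with the alternative Daugavet property *)

Section Separable.
Hypothesis Esep : separable E.

Lemma trunc_cvg x : (fun n => trunc n x) @ \oo --> x.
Proof.
have [l lP] := cauchy_rnorm_cvg (fun e e0 => trunc_cauchy x Esep e0).
suff xl : x = l by move: lP; rewrite -xl.
move/(cvg_rnormP V) : lP => lP; apply: Xinj; apply/funext => k.
apply/eqP; rewrite eq_sym -subr_eq0 -(rmod_eq0 V) eq_le rmod_ge0 andbT.
apply/ler_addgt0Pr => e /lP[N hN]; rewrite add0r.
have := hN (maxn N k.+1) (leq_maxl _ _); move/ltW; apply: le_trans.
apply: le_trans (coord_le _ k).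
by rewrite coordD coordN coord_restr leq_maxr.
Qed.

Lemma rnorm_trunc_cvg x e : 0 < e -> exists N, forall n, (N <= n)%N ->
  rnorm (x - trunc n x) < e.
Proof. by move=> e0; have /(cvg_rnormP V)/(_ e e0) := trunc_cvg (x := x). Qed.

Lemma rnorm_le_trunc x M : (forall n, rnorm (trunc n x) <= M) -> rnorm x <= M.
Proof.
move=> h; apply/ler_addgt0Pr => e e0; have [N hN] := rnorm_trunc_cvg x e0.
by rewrite (le_trans (rnorm_sub V x (trunc N x))) // lerD ?h // ltW // hN.
Qed.

Lemma real_norm_trunc n x :
  real_norm (fun k => rmod (X (trunc n x) k)) = rnorm (trunc n x).
Proof.
have fs : finsupp (fun k => rmod (X (trunc n x) k)).
  by exists n => k nk; rewrite coord_restr ltnNge nk rmod0.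
by apply/le_anti/andP; split; apply: rnorm_mono => k;
  rewrite coord_of_real // rmod_emb // rmod_ge0.
Qed.

Lemma coord_sum x (s : seq nat) : rmod (\sum_(i <- s) (X x i : K)) <=
  (size s)%:R * rnorm x.
Proof.
apply: le_trans (rmod_sum V s xpredT (X x)) _.
apply: le_trans (ler_sum _ (G := fun=> rnorm x) _) _ => [i _|];
  first exact: coord_le.
by rewrite big_const_seq iter_addr addr0 count_predT mulr_natl.
Qed.

(** The vector given by the Daugavet property is truncated before taking moduli,
   as [daugavet_means] is about finitely supported sequences only. *)
Lemma real_norm_daugavet_means : daugavet_approx V E ->
  daugavet_means real_norm.
Proof.
move=> ad s t e us ut s0 t0 Ns Nt e0.
have fs r := finsupp_indseq R r.
have sz0 (r : seq nat) : r != [::] -> 0 < (size r)%:R :> R.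
  by move=> r0; rewrite ltr0n lt0n size_eq0.
have ss := sz0 _ s0; have st := sz0 _ t0.
pose b k := (size t)%:R^-1 * indseq R t k.
have fb : finsupp b by exact: finsuppZ.
have b0 k : 0 <= b k by rewrite mulr_ge0 ?invr_ge0 ?ler0n.
pose x0 := of_real b.
have nx0 : rnorm x0 = 1.
  rewrite -/(real_norm b) (symm_scale real_norm_symmetric) ?invr_ge0 ?ler0n //.
  by rewrite Nt mulVf // gt_eqF.
pose mean x : K := emb (size s)%:R^-1 * \sum_(i <- s) (X x i : K).
have mean_le x : rmod (mean x) <= rnorm x.
  rewrite rmodM rmod_emb ?invr_ge0 ?ler0n // ler_pdivrMl //; exact: coord_sum.
have [T TE] : exists T : {linear E -> E}, forall x, T x = mean x *: x0.
  apply: (linear_pack (T := fun x => mean x *: x0)) => c x y.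
  rewrite scalerA -scalerDl; congr (_ *: _).
  rewrite /mean [c * _]mulrCA -mulrDr [c * _]mulr_sumr -big_split /=;
    congr (_ * _).
  by apply: eq_bigr => i _; rewrite coordD coordZ.
have T1 x : rnorm (T x) <= 1 * rnorm x.
  by rewrite TE rnormZ nx0 mulr1 mul1r mean_le.
have cT : continuous T by exact: rnorm_bounded_continuous T1.
pose z := of_real (indseq R s).
have meanz : mean z = 1.
  rewrite /mean (eq_big_seq (fun=> 1)).
    rewrite big_const_seq iter_addr addr0 count_predT -(rmorph_nat emb)
      -rmorphM.
    by rewrite mulVf ?rmorph1 // gt_eqF.
  by move=> i si; rewrite coord_of_real // /indseq si rmorph1.
have Tz : T z = x0 by rewrite TE meanz scale1r.
have T1' x : rnorm x <= 1 -> rnorm (T x) <= 1.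
  by move=> x1; rewrite (le_trans (T1 x)) // mul1r.
have oT : ropnorm V T = 1.
  apply/le_anti; rewrite (ropnorm_le T1') /= -{1}nx0 -Tz;
    apply: (ropnorm_ub T1').
  by rewrite -/(real_norm _) Ns.
have rT : rank_one T.
  exists x0; first by rewrite -(rnorm_eq0 V) nx0 oner_eq0.
  apply/seteqP; split=> [_ [x _ <-]|_ [c _ <-]]; first by exists (mean x);
    rewrite ?TE.
  by exists (c *: z) => //; rewrite linearZ /= Tz.
have e2 : 0 < e / 2 by rewrite divr_gt0.
have [theta [x [th1 x1 hx]]] := ad T cT rT _ e2; rewrite oT in hx.
have e4 : 0 < e / 4 by rewrite divr_gt0.
have [m /(_ m (leqnn m)) hm] := rnorm_trunc_cvg x e4.
set x' := trunc m x in hm.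
have x'1 : rnorm x' <= 1 by apply: le_trans (rnorm_restr _ _) x1.
have hx' : 2 - e < rnorm (x' + theta *: T x').
  have := rnorm_sub V (x + theta *: T x) (x' + theta *: T x').
  have -> : x + theta *: T x - (x' + theta *: T x') =
            (x - x') + theta *: T (x - x').
    by rewrite linearB scalerBr opprD addrACA.
  have := rnormD V (x - x') (theta *: T (x - x')).
  rewrite rnormZ th1 mul1r; have := T1 (x - x'); lra.
pose y k := rmod (X x' k).
have fy : finsupp y.
  by exists m => k mk; rewrite /y coord_restr ltnNge mk rmod0.
exists y; split => //.
- by move=> k; exact: rmod_ge0.
- by rewrite real_norm_trunc.
- have : rmod (mean x') <= (size s)%:R^-1 * \sum_(i <- s) y i.
    rewrite rmodM rmod_emb ?invr_ge0 ?ler0n // ler_wpM2l ?invr_ge0 ?ler0n //.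
    exact: rmod_sum.
  have : 1 - e <= rmod (mean x').
    have := rnormD V x' (theta *: T x').
    have nTx' : rnorm (T x') = rmod (mean x') by rewrite TE rnormZ nx0 mulr1.
    rewrite rnormZ th1 mul1r nTx'; lra.
  move=> h1 h2; have := le_trans h1 h2; by rewrite ler_pdivlMl.
- apply: lt_le_trans hx' _; apply: rnorm_mono => k.
  have fyb : finsupp (fun k => y k + b k) by exact: finsuppD.
  have hb : rmod (X (theta *: T x') k) <= b k.
    rewrite coordZ TE coordZ (coord_of_real k fb) rmodM th1 mul1r rmodM
      (rmod_emb V (b0 k)).
    by rewrite ler_piMl // (le_trans (mean_le _)).
  rewrite (coord_of_real k fyb) [leRHS]rmod_emb ?addr_ge0 ?rmod_ge0 //.
  by rewrite coordD (le_trans (rmodD V _ _)) // lerD.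
Qed.

Lemma l1_of_real_norm : (forall n, real_norm (indseq R (iota 0 n)) = n%:R) ->
  is_l1 X.
Proof.
move=> h.
have nT n x : rnorm (trunc n x) = \sum_(0 <= k < n) rmod (X x k).
  rewrite -real_norm_trunc (symm_l1 real_norm_symmetric h (n := n)).
  - by apply: eq_big_nat => k /andP[_ kn]; rewrite coord_restr kn.
  - by move=> k; exact: rmod_ge0.
  - by move=> k nk; rewrite coord_restr ltnNge nk rmod0.
have l1X x : l1 (X x) /\ l1norm (X x) = emb (rnorm x).
  apply: l1_cvg; apply/(cvg_rnormP V) => e /(rnorm_trunc_cvg x)[N hN].
  exists N => n /hN; apply: le_lt_trans.
  rewrite (series_norm_emb V) -nT -rmorphB rnorm_scalar rmod_embE ler_norml.
  have := rnorm_sub V x (trunc n x); have := rnorm_sub V (trunc n x) x.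
  by rewrite (rnormB V (trunc n x)) => ? ?; apply/andP; split; lra.
split; last by move=> x; have [_ ->] := l1X x; rewrite rnormE.
apply/seteqP; split=> [_ [x _ <-]|f /(ri_l1 ri)[x Xx _]].
  by have [] := l1X x.
by exists x.
Qed.

(** The norm is first bounded by the supremum for truncations, hence for all
   vectors; with it, truncations of a sequence tending to zero are Cauchy. *)
Lemma c0_of_real_norm : (forall n, real_norm (indseq R (iota 0 n.+1)) = 1) ->
  is_c0 X.
Proof.
move=> h.
have nT n x M : (forall k, rmod (X x k) <= M) -> rnorm (trunc n x) <= M.
  move=> xM; have M0 : 0 <= M by apply: le_trans (rmod_ge0 V _) (xM 0%N).
  apply: le_trans (_ : rnorm (trunc n.+1 x) <= _).
    apply: rnorm_mono => k; rewrite !coord_restr ltnS.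
    by case: ltnP => kn; rewrite ?(ltnW kn) // rmod0 rmod_ge0.
  by have := rnorm_trunc_le n.+1 M0 xM; rewrite h mulr1.
have nX x M : (forall k, rmod (X x k) <= M) -> rnorm x <= M.
  by move=> xM; apply: rnorm_le_trunc => n; apply: nT.
split; last first.
  move=> x; rewrite (supnorm_sup (coord_le x)) -(rnormE V); congr (emb _).
  apply/le_anti/andP; split.
    apply: nX => k; apply: ub_le_sup; last by exists k.
    by exists (rnorm x) => _ [n _ <-]; exact: coord_le.
  by apply: ge_sup; [exists (rmod (X x 0%N)), 0%N|move=> _ [n _ <-];
    exact: coord_le].
apply/seteqP; split=> [_ [x _ <-]|f].
  apply/(cvg_rnormP V) => e /(rnorm_trunc_cvg x)[N hN]; exists N => n /hN.
  apply: le_lt_trans; rewrite sub0r rnormN rnorm_scalar.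
  apply: le_trans (coord_le _ n).
  by rewrite coordD coordN coord_restr ltnn subr0.
move=> /(cvg_rnormP V) f0.
pose u n := of_seq (fun k => if (k < n)%N then f k else 0).
have Xu n k : X (u n) k = if (k < n)%N then f k else 0.
  rewrite of_seqK //; apply: (range_finsupp (n := n)) => j nj.
  by rewrite ltnNge nj.
have [|l lP] := @cauchy_rnorm_cvg _ _ V E u.
  move=> e e0; have [|N hN] := f0 (e / 2); first exact: divr_gt0.
  exists N => m n Nm mn; apply: (@le_lt_trans _ _ (e / 2)); last by lra.
  apply: nX => k; rewrite coordD coordN !Xu.
  case: (ltnP k m) => km.
    by rewrite (leq_trans km mn) subrr rmod0 divr_ge0 // ltW.
  rewrite subr0; case: ifP => _; last by rewrite rmod0 divr_ge0 // ltW.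
  have := hN k (leq_trans Nm km); rewrite sub0r rnormN rnorm_scalar; exact: ltW.
exists l => //; move/(cvg_rnormP V) : lP => lP; apply/funext => k.
apply/eqP; rewrite -subr_eq0 -(rmod_eq0 V) eq_le rmod_ge0 andbT.
apply/ler_addgt0Pr => e /lP[N hN]; rewrite add0r.
have := hN (maxn N k.+1) (leq_maxl _ _); move/ltW; apply: le_trans.
apply: le_trans (coord_le _ k).
by rewrite coordD coordN Xu leq_maxr.
Qed.

Lemma daugavet_c0_or_l1 : daugavet_approx V E -> is_c0 X \/ is_l1 X.
Proof.
move=> /real_norm_daugavet_means.
move=> /(symm_dichotomy real_norm_symmetric)[h|h].
  by left; exact: c0_of_real_norm.
by right; exact: l1_of_real_norm.
Qed.

(** * States of c0 and l1 *)

Definition unit_vec k : E := of_real (indseq R [:: k]).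

Lemma coord_unit k n : X (unit_vec k) n = (n == k)%:R.
Proof.
rewrite coord_of_real; last exact: finsupp_indseq.
by rewrite /indseq mem_seq1 rmorph_nat.
Qed.

Lemma rnorm_unit k : rnorm (unit_vec k) = 1.
Proof. exact: (symm_unit real_norm_symmetric). Qed.

Lemma functional_state (T : {linear E -> E}) e (z : E) (phi : E -> K^o) :
  linear phi -> (forall x, rmod (phi x) <= rnorm x) -> rnorm z <= 1 ->
    phi z = 1 ->
  ropnorm V T - e < rmod (phi (T z)) ->
  exists (x : E) (phi : {linear E -> K^o}),
    [/\ `|x| = 1, continuous phi, opnorm phi = 1, phi x = 1
      & ropnorm V T - e < rmod (phi (T x))].
Proof.
move=> lphi phi1 z1 phiz hz; have [psi psiE] := linear_pack lphi.
have psi1 x : rnorm (psi x) <= 1 * rnorm x by rewrite rnorm_scalar psiE mul1r.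
have nz : rnorm z = 1.
  by apply/le_anti; rewrite z1 /= -(rmod1 V) -phiz phi1.
exists z, psi; split; rewrite ?psiE //.
- by rewrite -(rnormE V) nz rmorph1.
- exact: rnorm_bounded_continuous psi1.
- rewrite (@opnorm_attained _ _ V _ _ _ 1) ?rmorph1 //.
    by move=> x x1; rewrite (le_trans (psi1 x)) // mul1r.
  by exists z => //; rewrite rnorm_scalar psiE phiz rmod1.
Qed.

(** In [c0] the norm of [T x] is nearly attained at a coordinate [k], which
   depends affinely on the [k]-th coordinate of [x]: the latter can be moved to
   the unit circle, where the evaluation at [k] is a state. *)
Lemma c0_index_one : is_c0 X -> numerical_index_one E.
Proof.
move=> [_ nX]; apply: (@numerical_approx_index_one _ _ V) => T cT e e0.
have bS x : has_ubound [set rmod (X x n) | n in [set: nat]].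
  by exists (rnorm x) => _ [n _ <-]; exact: coord_le.
have nS x : rnorm x = sup [set rmod (X x n) | n in [set: nat]].
  by apply: (emb_inj (V := V)); rewrite rnormE nX (supnorm_sup (coord_le x)).
have e2 : 0 < e / 2 by rewrite divr_gt0.
have [M hM] := continuous_ball_bounded V cT.
have [x x1 hx] := ropnorm_adherent hM e2.
have [_ [k _ <-]] : exists2 r, [set rmod (X (T x) n) | n in [set: nat]] r
    & rnorm (T x) - e / 2 < r.
  by rewrite nS; apply: sup_adherent => //; split => //;
    exists (rmod (X (T x) 0%N)), 0%N.
move=> hk; pose w := x - (X x k : K) *: unit_vec k.
pose a : K := X (T w) k; pose b : K := X (T (unit_vec k)) k.
have [pa pa1 paE] := phase V a; have [pb pb1 pbE] := phase V b.
have pa0 : pa != 0 by rewrite -(rmod_eq0 V) pa1 oner_eq0.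
(* This value of the [k]-th coordinate aligns the phases of [a] and [u * b]. *)
pose u := pb / pa.
have u1 : rmod u = 1.
  have : rmod (u * pa) = 1 by rewrite /u divfK.
  by rewrite rmodM pa1 mulr1.
have u0 : u != 0 by rewrite -(rmod_eq0 V) u1 oner_eq0.
have uV : rmod u^-1 = 1.
  have : rmod (u^-1 * u) = 1 by rewrite mulVf // rmod1.
  by rewrite rmodM u1 mulr1.
have Tz c : X (T (w + c *: unit_vec k)) k = a + c * b.
  by rewrite linearD coordD linearZ coordZ.
pose z := w + u *: unit_vec k.
have Xz n : X z n = if n == k then u else X x n.
  rewrite !coordD coordN !coordZ coord_unit; case: eqP => [->|_].
    by rewrite !mulr1 subrr add0r.
  by rewrite !mulr0 subr0 addr0.
apply: (@functional_state T e z (fun x => u^-1 * (X x k : K))).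
- by move=> c x' y'; rewrite coordD coordZ mulrDr mulrCA.
- by move=> x'; rewrite rmodM uV mul1r coord_le.
- rewrite nS; apply: ge_sup; first by exists (rmod (X z 0%N)), 0%N.
  move=> _ [n _ <-]; rewrite Xz; case: eqP => _; first by rewrite u1.
  exact: le_trans (coord_le x n) x1.
- by rewrite Xz eqxx mulVf.
- rewrite rmodM uV mul1r Tz.
  have -> : rmod (a + u * b) = rmod a + rmod b.
    rewrite -[LHS]mul1r -pa1 -rmodM mulrDr paE /u mulrA mulrCA mulfV //
      mulr1 pbE.
    by rewrite -rmorphD rmod_emb // addr_ge0 ?rmod_ge0.
  have Tx : X (T x) k = a + (X x k : K) * b by rewrite -Tz subrK.
  rewrite Tx in hk.
  have := rmodD V a ((X x k : K) * b); rewrite rmodM.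
  have : rmod (X x k) * rmod b <= rmod b.
    by rewrite ler_piMl ?rmod_ge0 // (le_trans (coord_le x k)).
  lra.
Qed.

(** In [l1] the norm of [T] is the supremum of the norms of the images of the
   unit vectors, and at a unit vector there are states that adjust the phases of
   finitely many other coordinates. *)
Lemma l1_index_one : is_l1 X -> numerical_index_one E.
Proof.
move=> [_ nX]; apply: (@numerical_approx_index_one _ _ V) => T cT e e0.
have nT n x : rnorm (trunc n x) = \sum_(0 <= k < n) rmod (X x k).
  have [|_ nl] := @l1_finsupp _ _ V (X (trunc n x)) n.
    by move=> k nk; rewrite coord_restr ltnNge nk.
  apply: (emb_inj (V := V)); rewrite rnormE nX nl; congr (emb _).
  by apply: eq_big_nat => k /andP[_ kn]; rewrite coord_restr kn.
have e3 : 0 < e / 3 by rewrite divr_gt0.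
have [M hM] := continuous_ball_bounded V cT.
have [x x1 hx] := ropnorm_adherent hM e3.
have T0 := ropnorm_ge0 V cT.
have T1 : 0 < ropnorm V T + 1 by lra.
have [k hk] : exists k, ropnorm V T - e * 2 / 3 < rnorm (T (unit_vec k)).
  apply: contrapT => h.
  have {}h k : rnorm (T (unit_vec k)) <= ropnorm V T - e * 2 / 3.
    by rewrite leNgt; apply/negP => hk; apply: h; exists k.
  set c := ropnorm V T - _ in h.
  have c0 : 0 <= c by apply: le_trans (rnorm_ge0 V _) (h 0%N).
  have [N /(_ N (leqnn N)) hN] := rnorm_trunc_cvg x (divr_gt0 e3 T1).
  have xE : trunc N x = \sum_(0 <= k < N) (X x k : K) *: unit_vec k.
    apply: Xinj; apply/funext => n; rewrite coord_restr.
    rewrite (big_morph (fun y => X y n : K) (fun y z =>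
      coordD y z n) (id1 := 0)).
      case: ltnP => nN.
        rewrite (bigD1_seq n) ?iota_uniq ?mem_index_iota //= coordZ coord_unit.
        rewrite eqxx mulr1 big1 ?addr0 // => k kn.
        by rewrite coordZ coord_unit eq_sym (negbTE kn) mulr0.
      rewrite big1_seq // => k; rewrite mem_index_iota => /= kN.
      by rewrite coordZ coord_unit gtn_eqF ?mulr0 // (leq_trans kN).
    by rewrite linear0.
  have : rnorm (T (trunc N x)) <= c.
    rewrite xE linear_sum (le_trans (rnorm_sum _ _ _ _)) //.
    apply: (@le_trans _ _ (\sum_(0 <= k < N) rmod (X x k) * c)).
      by apply: ler_sum => k _; rewrite linearZ rnormZ ler_wpM2l ?rmod_ge0.
    rewrite -mulr_suml -nT ler_piMl //.
    exact: le_trans (rnorm_restr _ _) x1.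
  have := rnorm_sub V (T x) (T (trunc N x)); rewrite -linearB.
  have := ropnorm_rnorm V cT (x - trunc N x).
  have : ropnorm V T * rnorm (x - trunc N x) <= e / 3.
    apply: le_trans (ler_wpM2l T0 (ltW hN)) _.
    rewrite mulrCA ler_piMr ?(ltW e3) // ler_pdivrMr // mul1r; lra.
  rewrite /c; lra.
set w := T (unit_vec k) in hk.
have [N hN] := rnorm_trunc_cvg w e3; pose m := maxn N k.+1.
have {}hN := hN m (leq_maxl _ _).
have km : (k < m)%N by rewrite leq_maxr.
have hm : ropnorm V T - e < rnorm (trunc m w)
  by have := rnorm_sub V w (trunc m w); lra.
have /choice[p pP] j : exists u,
  rmod u = 1 /\ u * (X w j : K) = emb (rmod (X w j)).
  by have [u] := phase V (X w j); exists u.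
have pk0 : p k != 0 by rewrite -(rmod_eq0 V) (pP k).1 oner_eq0.
have pkV : rmod (p k)^-1 = 1.
  have : rmod ((p k)^-1 * p k) = 1 by rewrite mulVf // rmod1.
  by rewrite rmodM (pP k).1 mulr1.
apply: (@functional_state T e (unit_vec k)
  (fun x => (p k)^-1 * \sum_(0 <= j < m) p j * (X x j : K))).
- move=> c y z; set S := \sum_(_ <= _ < _) _; set Sy := \sum_(_ <= _ < _) _.
  set Sz := \sum_(_ <= _ < _) _; suff -> : S = c * Sy + Sz.
    by rewrite mulrDr; congr (_ + _); exact: mulrCA.
  rewrite mulr_sumr -big_split /=.
  by apply: eq_bigr => j _; rewrite coordD coordZ mulrDr mulrCA.
- move=> y; rewrite rmodM pkV mul1r (le_trans (rmod_sum _ _ _ _)) //.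
  apply: le_trans (rnorm_restr (fun j => j < m)%N y); rewrite -/(trunc m y) nT.
  by apply: ler_sum => j _; rewrite rmodM (pP j).1 mul1r.
- by rewrite rnorm_unit.
- rewrite (bigD1_seq k) ?iota_uniq ?mem_index_iota //= coord_unit eqxx mulr1.
  rewrite big1 ?addr0 ?mulVf // => j jk.
  by rewrite coord_unit (negbTE jk) mulr0.
- rewrite rmodM pkV mul1r (eq_bigr (fun j => emb (rmod (X w j)))).
    by rewrite -rmorph_sum -nT rmod_emb // rnorm_ge0.
  by move=> j _; rewrite (pP j).2.
Qed.

Lemma ri_index_one_daugavet :
  (numerical_index_one E <-> is_c0 X \/ is_l1 X) /\
  (alternative_Daugavet E <-> is_c0 X \/ is_l1 X).
Proof.
have back : is_c0 X \/ is_l1 X -> numerical_index_one E.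
  by case; [exact: c0_index_one|exact: l1_index_one].
have fwd : alternative_Daugavet E -> is_c0 X \/ is_l1 X.
  by move=> /(alternative_daugavet_approx V)/daugavet_c0_or_l1.
split; split=> //; first by move=> /(index_one_daugavet V)/fwd.
by move=> /back/(index_one_daugavet V).
Qed.

End Separable.

End Kothe.

(** * The real and the complex scalars *)

Section Instances.
Variable R : realType.

Lemma real_circle_max (g : R -> R) (L : R) :
  (forall a b, `|g a - g b| <= L * `|a - b|) ->
  exists2 theta, `|theta| = 1 & forall eta, `|eta| = 1 -> g eta <= g theta.
Proof.
move=> _; have sgn eta : `|eta| = 1 -> eta = 1 \/ eta = -1 :> R.
  by case: (ler0P eta) => _ <-; [right; rewrite opprK|left].
case: (leP (g 1) (g (-1))) => h.
  by exists (-1); rewrite ?normrN1 // => eta /sgn[]->.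
by exists 1; rewrite ?normr1 // => eta /sgn[]-> //; exact: ltW.
Qed.

Definition real_norm_values : norm_values R R :=
  @Build_norm_values R R (GRing.RMorphism.clone _ _ (@idfun R) _) (fun a =>
    `|a|)
    (fun _ _ => erefl) (fun _ => erefl) real_circle_max.

Definition cmod (a : R[i]) : R := complex.Re `|a|.

Lemma cmodE a : (cmod a)%:C%C = `|a|.
Proof. by rewrite /cmod RRe_real // normr_real. Qed.

Lemma cmod_sqrt (x y : R) : cmod (x +i* y)%C = Num.sqrt (x ^+ 2 + y ^+ 2).
Proof. by rewrite /cmod normc_def. Qed.

Lemma cmod_le (x y : R) : cmod (x +i* y)%C <= `|x| + `|y|.
Proof.
rewrite cmod_sqrt -[leRHS]ger0_norm ?addr_ge0 // -sqrtr_sqr ler_wsqrtr //.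
rewrite sqrrD !real_normK ?num_real // lerD2r lerDl mulrn_wge0 // mulr_ge0 //.
Qed.

(** The two halves of the circle are graphs over the segment from -1 to 1, where
   continuous functions attain their maximum. *)
Lemma arc_max (g : R[i] -> R) (L : R) (q : R -> R) :
  (forall a b, `|g a - g b| <= L * cmod (a - b)) -> continuous q ->
  exists2 c, `|c| <= 1 &
    forall t, `|t| <= 1 -> g (t +i* q t)%C <= g (c +i* q c)%C.
Proof.
move=> gL cq; pose f t := g (t +i* q t)%C.
have L0 : 0 <= `|L| by [].
have fL s t : `|f s - f t| <= `|L| * (`|s - t| + `|q s - q t|).
  apply: le_trans (gL _ _) _; rewrite -[(_ - _ : R[i])]/(_ +i* _)%C.
  apply: (@le_trans _ _ (`|L| * cmod ((s - t) +i* (q s - q t))%C)).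
    by rewrite ler_wpM2r ?ler_norm // cmod_sqrt sqrtr_ge0.
  by rewrite ler_wpM2l // cmod_le.
have cf : continuous f.
  move=> s; apply/cvgrPdist_lt => e e0.
  have d0 : 0 < e / (2 * (`|L| + 1)) by rewrite divr_gt0 // mulr_gt0 //; lra.
  have /cvgrPdist_lt/(_ _ d0) hq := cq s.
  have /cvgrPdist_lt/(_ _ d0) hs : t @[t --> s] --> s by exact: cvg_id.
  near=> t; apply: le_lt_trans (fL s t) _.
  have h1 : `|s - t| < e / (2 * (`|L| + 1)) by near: t.
  have h2 : `|q s - q t| < e / (2 * (`|L| + 1)) by near: t.
  have L1 : 0 < `|L| + 1 by lra.
  apply: (@le_lt_trans _ _ (`|L| * (2 * (e / (2 * (`|L| + 1)))))).
    by rewrite ler_wpM2l //; lra.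
  have -> : 2 * (e / (2 * (`|L| + 1))) = e / (`|L| + 1) by field;
    rewrite gt_eqF.
  by rewrite mulrA ltr_pdivrMr // mulrDr mulr1 mulrC; lra.
have [//||c cI hc] := @EVT_max _ f (-1) 1; first by lra.
  exact: continuous_subspaceT.
exists c; first by move: cI; rewrite in_itv /= ler_norml.
by move=> t t1; apply: hc; rewrite in_itv /= -ler_norml.
Unshelve. all: by end_near.
Qed.

Lemma complex_circle_max (g : R[i] -> R) (L : R) :
  (forall a b, `|g a - g b| <= L * cmod (a - b)) ->
  exists2 theta, cmod theta = 1 & forall eta, cmod eta = 1 -> g eta <= g theta.
Proof.
move=> gL; pose q (t : R) := Num.sqrt (1 - t ^+ 2).
have cq : continuous q.
  move=> t; apply: continuous_comp; last exact: sqrt_continuous.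
  by apply: cvgB; [exact: cvg_cst|exact: exprn_continuous].
have cN : continuous (fun t => - q t) by move=> t; apply: cvgN; exact: cq.
have [c c1 hc] := arc_max gL cq; have [d d1 hd] := arc_max gL cN.
have sq1 t : `|t| <= 1 -> t ^+ 2 + q t ^+ 2 = 1.
  move=> t1; rewrite sqr_sqrtr; first lra.
  by rewrite subr_ge0 -real_normK ?num_real // expr_le1.
have hsplit eta : cmod eta = 1 ->
  g eta <= g (c +i* q c)%C \/ g eta <= g (d +i* - q d)%C.
  case: eta => x y; rewrite cmod_sqrt => /(congr1 (fun r => r ^+ 2)).
  rewrite sqr_sqrtr ?addr_ge0 ?sqr_ge0 // expr1n => xy.
  have x1 : `|x| <= 1.
    rewrite -(expr_le1 (n := 2)) // real_normK ?num_real //.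
    by have := sqr_ge0 y; lra.
  have qx : q x = `|y|.
    by rewrite /q (_ : 1 - x ^+ 2 = y ^+ 2) ?sqrtr_sqr //; lra.
  have [y0|y0] := leP 0 y.
    by left; have := hc x x1; rewrite qx ger0_norm.
  by right; have := hd x x1; rewrite qx ltr0_norm // opprK.
have cc : cmod (c +i* q c)%C = 1 by rewrite cmod_sqrt sq1 // sqrtr1.
have dd : cmod (d +i* - q d)%C = 1 by rewrite cmod_sqrt sqrrN sq1 // sqrtr1.
case: (leP (g (c +i* q c)%C) (g (d +i* - q d)%C)) => h.
  exists (d +i* - q d)%C => // eta /hsplit[]// => h'; exact: le_trans h' h.
exists (c +i* q c)%C => // eta /hsplit[]// => h'; exact: le_trans h' (ltW h).
Qed.

Definition complex_norm_values : norm_values R R[i] :=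
  @Build_norm_values R R[i] (GRing.RMorphism.clone _ _ (real_complex R) _) cmod
    (@lecR R) cmodE complex_circle_max.

End Instances.

Theorem corollary3p6 (R : realType) :
  (forall (E : completeNormedModType R) (X : {linear E -> (nat -> R^o)}),
     rearrangement_invariant X -> separable E ->
     (numerical_index_one E <-> is_c0 X \/ is_l1 X) /\
     (alternative_Daugavet E <-> is_c0 X \/ is_l1 X)) /\
  (forall (E : completeNormedModType R[i]) (X : {linear E -> (nat -> R[i]^o)}),
     rearrangement_invariant X -> separable E ->
     (numerical_index_one E <-> is_c0 X \/ is_l1 X) /\
     (alternative_Daugavet E <-> is_c0 X \/ is_l1 X)).
Proof.
split=> E X ri sE.
  exact: (ri_index_one_daugavet (real_norm_values R) ri sE).
exact: (ri_index_one_daugavet (complex_norm_values R) ri sE).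
Qed.
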